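(* Suppose that: - $t\mapsto S_t$ is right lower semicontinuous for $\mathbb{P}^\mu$-a.e. $\omega$, the predictable projection of $S$ is left lower semicontinuous, and $S$ is bounded below; - $\mathbb{P}^\mu$-a.s. $S_t=S_{\tau_{\mathfrak{C}}}$ for all $t>\tau_{\mathfrak{C}}$, and $\{S_\sigma:\sigma\in\mathcal{S}\}$ is uniformly integrable; - $X$ is a stationary Feller process, and $\phi^{\mathrm{re}}\in C_b(O_{\mathfrak{C}})$ for every $\phi\in C_b(O_{\mathfrak{C}})$; - $S_0=0$ and $S$ is an $(\Omega,\mathbb{F},\mathbb{P}^\mu)$-submartingale. Let $\psi\in C_b(O_{\mathfrak{C}})$ and $\bar\psi=\psi-\psi^{\mathrm{re}}$. Then $$G_t^{\bar\psi}=G_t^\psi-\psi^{\mathrm{re}}(X_t).$$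
   Context: Setting. $\mathbb{R}^+=[0,\infty)$. $O$ is a complete metric space and $O_{\mathfrak{C}}=O\cup\{\mathfrak{C}\}$, where the cemetery state $\mathfrak{C}$ has distance $1$ from every other point. $(\Omega,\mathbb{F}=(\mathcal{F}_t)_{t\in\mathbb{R}^+},\mathbb{P}^\mu)$ is a filtered probability space with $\Omega$ Polish, $\mathbb{P}^\mu$ a Borel probability measure, $\mathbb{F}$ right continuous and $\mathcal{F}_0$ containing the $\mathbb{P}^\mu$-null sets. $X:\Omega\to D(\mathbb{R}^+;O_{\mathfrak{C}})$ is a continuous map into the Skorokhod space of càdlàg paths, and $X$ is adapted to $\mathbb{F}$. $\mathcal{S}$ is the set of ($\mathbb{R}^+$-valued) $\mathbb{F}$-stopping times and $\mathcal{S}_t=\{\sigma\in\mathcal{S}:\sigma\ge t\}$. $\mu$ is a Borel probability measure on $O$ and is the law of $X_0$ under $\mathbb{P}^\mu$. $\tau_{\mathfrak{C}}=\inf\{t:X_t=\mathfrak{C}\}$; it is assumed that $\mathbb{E}^{\mathbb{P}^\mu}[\tau_{\mathfrak{C}}]<\infty$ and that $\mathbb{P}^\mu$-a.s. $X_t=\mathfrak{C}$ for $t\ge\tau_{\mathfrak{C}}$. For every nonempty open $Q\subset O$ there is $\sigma\in\mathcal{S}$ with $\mathbb{P}^\mu(X_\sigma\in Q)>0$. $C_b$ denotes bounded continuous functions. The cost process $S$ is a real adapted process on $\mathbb{R}^+\times\Omega$, jointly measurable (Borel on $\mathbb{R}^+$, $\mathbb{P}^\mu$-completed Borel on $\Omega$).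 Value process. $G^\psi_t=\sup_{\sigma\in\mathcal{S}_t}\mathbb{E}^{\mathbb{P}^\mu}[\psi(X_\sigma)-S_\sigma\,|\,\mathcal{F}_t]$ (essential supremum), the Snell envelope of $(\psi(X_t)-S_t)_t$; identities between such processes are understood $\mathbb{P}^\mu$-a.s. for every $t\in\mathbb{R}^+$. Feller process. $X$ is a stationary Feller process if there is a probability transition semigroup $P(t,x,\cdot)$ on $O_{\mathfrak{C}}$, with $P(t,x,\cdot)=\int_{O_{\mathfrak{C}}}P(t-s,y,\cdot)P(s,x,dy)$ for $0<s<t$, such that $P(t,x,\cdot)$ is the law of $X_t$ given $X_0=x$, $X$ is (time-homogeneous) Markov with respect to $\mathbb{F}$ with this semigroup, and $\int f(y)P(t,\cdot,dy)\to f$ uniformly as $t\to0$ for all $f\in C_b(O_{\mathfrak{C}})$. $\mathbb{P}^x,\mathbb{E}^x$ refer to the process started at $x$, and $\mathcal{S}^x$ is the set of (nonrandomized) stopping times on its probability space. Réduite: $\psi^{\mathrm{re}}(x)=\sup_{\sigma\in\mathcal{S}^x}\mathbb{E}^x[\psi(X_\sigma)]$ for $x\in O_{\mathfrak{C}}$.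
   Formalization: Here ''submartingale'' means that S_σ is integrable and E[S_τ|F_σ] ≥ S_σ for all stopping times σ ≤ τ; with the inequality only at deterministic times the claim can fail, since S is only right lower semicontinuous. *)

(* Defs.v *)
From HB Require Import structures.
From mathcomp Require Import all_boot all_order all_algebra.
From mathcomp Require Import all_classical all_reals all_analysis.
From mathcomp Require Import measurable_realfun.
From mathcomp Require Import lra.

Set Implicit Arguments.
Unset Strict Implicit.
Unset Printing Implicit Defensive.

Import Order.TTheory GRing.Theory Num.Theory.
Import numFieldNormedType.Exports.

Local Open Scope classical_set_scope.
Local Open Scope ring_scope.

(* Time is [R] throughout; only nonnegative times are ever constrained. *)

#[short(type="completeMetricType")]
HB.structure Definition CompleteMetric (R : numDomainType) :=
  {T of Metric R T & Complete T & Pointed T}.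

#[short(type="topMeasurableType")]
HB.structure Definition TopMeasurable d :=
  {T of Topological T & Measurable d T}.

Notation borel T := (g_sigma_algebraType (@open T)).

Definition polish (R : realType) (T : topologicalType) : Prop :=
  exists dist : T -> T -> R,
    [/\ (forall x y, dist x y = 0 <-> x = y),
        (forall x y, dist x y = dist y x) &
        (forall x y z, dist x z <= dist x y + dist y z)] /\
    [/\ (forall (x : T) (A : set T), nbhs x A <->
           exists2 e : R, 0 < e & [set y | dist x y < e] `<=` A),
        (forall u : nat -> T,
           (forall e : R, 0 < e -> exists N : nat, forall m n : nat,
              (N <= m)%N -> (N <= n)%N -> dist (u m) (u n) < e) ->
           exists l : T, u @ \oo --> l) &
        (exists2 D : set T, countable D & dense D)].

Definition cem (O : Type) : Type := option O.
Definition alive {O : Type} (x : O) : cem O := Some x.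
Definition cemetery {O : Type} : cem O := None.

HB.instance Definition _ (O : choiceType) := Choice.copy (cem O) (option O).
HB.instance Definition _ (O : choiceType) :=
  isPointed.Build (cem O) (@cemetery O).

(* The distance of [O] is truncated at 2, which changes neither its topology
   nor its completeness: without this, a cemetery at distance 1 from every
   point would break the triangle inequality as soon as [O] has diameter
   larger than 2. *)
Section cemetery_metric.
Context {R : realType} {O : metricType R}.

Definition cem_dist (x y : cem O) : R :=
  match x, y with
  | Some a, Some b => Num.min (mdist a b) 2
  | None, None => 0
  | _, _ => 1
  end.

Lemma cem_distxx x : cem_dist x x = 0.
Proof.
case: x => [a|] //=; rewrite mdistxx; apply/min_idPl; lra.
Qed.

Lemma cem_dist_eq0 x y : cem_dist x y = 0 -> x = y.
Proof.
case: x y => [a|] [b|] //=; [|by move=> /eqP; rewrite oner_eq0..].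
rewrite minEle; case: ifP => _; first by move=> /mdist_positivity ->.
by move=> /eqP; rewrite pnatr_eq0.
Qed.

Lemma cem_dist_sym x y : cem_dist x y = cem_dist y x.
Proof. by case: x y => [a|] [b|] //=; rewrite metric_sym. Qed.

Lemma cem_dist_triangle y x z : cem_dist x z <= cem_dist x y + cem_dist y z.
Proof.
have ge0 (a b : O) : 0 <= mdist a b by exact: mdist_ge0.
case: x y z => [a|] [b|] [c|] //=; try lra.
- have := metric_triangle a b c; have := ge0 a b; have := ge0 b c.
  by case: (leP (mdist a b) 2); case: (leP (mdist b c) 2);
    case: (leP (mdist a c) 2) => *; lra.
- by have := ge0 a b; case: (leP (mdist a b) 2) => *; lra.
- by case: (leP (mdist a c) 2) => *; lra.
- by have := ge0 b c; case: (leP (mdist b c) 2) => *; lra.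
Qed.

HB.instance Definition _ :=
  isMetric.Build R (cem O) cem_distxx cem_dist_eq0 cem_dist_sym
    cem_dist_triangle.

End cemetery_metric.

Definition Cb (R : realType) (E : topologicalType) : set (E -> R) :=
  [set f | continuous f /\ bounded_fun f].
Arguments Cb : clear implicits.

Section skorokhod_space.
Context {R : realType} {E : metricType R}.

Record skorokhod := Skorokhod {
  path :> R -> E ;
  path_right_continuous :
    forall t, 0 <= t -> path s @[s --> t^'+] --> path t ;
  path_left_limit :
    forall t, 0 < t -> exists l : E, path s @[s --> t^'-] --> l }.

HB.instance Definition _ := gen_eqMixin skorokhod.
HB.instance Definition _ := gen_choiceMixin skorokhod.

Definition time_change (lam : R -> R) : Prop :=
  [/\ lam 0 = 0,
      (forall s t, 0 <= s -> s < t -> lam s < lam t) &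
      (forall u, 0 <= u -> exists2 s, 0 <= s & lam s = u)].

(* Jacod-Shiryaev's description of the J1 topology on the half-line: [x_n]
   tends to [x] iff there are time changes [lam_n] such that [lam_n - id] tends
   to 0 uniformly and [x_n \o lam_n] tends to [x] uniformly on every [0, N]. *)
Definition skorokhod_nbhd (x : skorokhod) (N e : R) : set skorokhod :=
  [set y | exists lam, [/\ time_change lam,
     (forall s, 0 <= s -> `|lam s - s| < e) &
     (forall s, 0 <= s <= N -> ball (x s) e (y (lam s)))]].

HB.instance Definition _ := hasNbhs.Build skorokhod
  (fun x => filter_from [set Ne : R * R | 0 < Ne.2]
              (fun Ne => skorokhod_nbhd x Ne.1 Ne.2)).

End skorokhod_space.
Arguments skorokhod {R} E.

Section processes.
Context {R : realType} {d : measure_display} {Omega : topMeasurableType d}.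
Variable P : probability Omega R.
Implicit Types (G : set (set Omega)) (F : R -> set (set Omega)).

(* The sigma-algebra of [Omega] is the [P]-completion of its Borel
   sigma-algebra. *)
Definition completed_borel : Prop :=
  @measurable d Omega = [set A | exists B C : set Omega,
    [/\ <<s @open Omega >> B, <<s @open Omega >> C,
        B `<=` A, A `<=` C & P (C `\` B) = 0%E]].

Definition measurable_wrt G d' (T : measurableType d') (f : Omega -> T) :=
  forall B, measurable B -> G (f @^-1` B).

Definition filtration F : Prop :=
  [/\ (forall t, 0 <= t -> sigma_algebra setT (F t)),
      (forall t, 0 <= t -> F t `<=` measurable) &
      (forall s t, 0 <= s -> s <= t -> F s `<=` F t)].

Definition right_continuous_filtration F : Prop :=
  forall t, 0 <= t -> F t = \bigcap_(s in [set s | t < s]) F s.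

Definition adapted F d' (T : measurableType d') (Y : R -> Omega -> T) :=
  forall t, 0 <= t -> measurable_wrt (F t) (Y t).

Definition stopping_time F : set (Omega -> R) :=
  [set sigma | (forall w, 0 <= sigma w) /\
               forall t, 0 <= t -> F t [set w | sigma w <= t]].

Definition stopping_time_after F (t : R) : set (Omega -> R) :=
  [set sigma | stopping_time F sigma /\ forall w, t <= sigma w].

Definition stopped_sigma_algebra F (sigma : Omega -> R) : set (set Omega) :=
  [set A | measurable A /\
           forall t, 0 <= t -> F t (A `&` [set w | sigma w <= t])].

Definition is_cond_exp G (f Y : Omega -> R) : Prop :=
  [/\ measurable_wrt G Y, P.-integrable setT (EFin \o Y) &
      forall A, G A -> (\int[P]_(w in A) (Y w)%:E = \int[P]_(w in A) (f w)%:E)%E].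

Definition cond_exp G (f : Omega -> R) : Omega -> R :=
  xget (cst 0) [set Y | is_cond_exp G f Y].

Definition is_ess_sup (H : set (Omega -> \bar R)) (Z : Omega -> \bar R) :=
  [/\ measurable_fun setT Z,
      (forall Y, H Y -> {ae P, forall w, (Y w <= Z w)%E}) &
      (forall Z', measurable_fun setT Z' ->
         (forall Y, H Y -> {ae P, forall w, (Y w <= Z' w)%E}) ->
         {ae P, forall w, (Z w <= Z' w)%E})].

Definition essential_sup (H : set (Omega -> \bar R)) : Omega -> \bar R :=
  xget (cst 0%E) [set Z | is_ess_sup H Z].

Definition uniformly_integrable (H : set (Omega -> R)) : Prop :=
  (forall f, H f -> measurable_fun setT f) /\
  forall e : R, 0 < e -> exists K : R, forall f, H f ->
    (\int[P]_(w in [set w | (K < `|f w|)%R]) `|f w|%:E <= e%:E)%E.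

(* Submartingale inequality at stopping times. [S] is not assumed to be right
   continuous, so this does not follow from its restriction to deterministic
   times. *)
Definition submartingale F (S : R -> Omega -> R) : Prop :=
  [/\ adapted F S,
      (forall sigma, stopping_time F sigma ->
         P.-integrable setT (fun w => (S (sigma w) w)%:E)) &
      (forall sigma tau, stopping_time F sigma -> stopping_time F tau ->
         (forall w, sigma w <= tau w) ->
         {ae P, forall w, S (sigma w) w <=
            cond_exp (stopped_sigma_algebra F sigma)
                     (fun w => S (tau w) w) w})].

Definition predictable F : set (set (R * Omega)) :=
  <<s [set p : R * Omega | 0 <= p.1],
      [set [set 0] `*` A | A in F 0] `|`
      [set C | exists s t A,
         [/\ 0 <= s, s < t, F s A & C = `]s, t]%classic `*` A]] >>.

Definition predictable_time F (tau : Omega -> \bar R) : Prop :=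
  (forall w, (0 <= tau w)%E) /\
  predictable F [set p : R * Omega | 0 <= p.1 /\ (tau p.2 <= p.1%:E)%E].

(* F_(tau-) *)
Definition strict_past F (tau : Omega -> \bar R) : set (set Omega) :=
  <<s F 0 `|` [set C | exists t A,
        [/\ 0 <= t, F t A & C = A `&` [set w | (t%:E < tau w)%E]]] >>.

(* Y_tau 1_{tau < oo} *)
Definition at_finite (Y : R -> Omega -> R) (tau : Omega -> \bar R) (w : Omega)
    : R :=
  if tau w is EFin t then Y t w else 0.

Definition predictable_projection F (S pS : R -> Omega -> R) : Prop :=
  (forall B : set R, measurable B ->
     predictable F [set p : R * Omega | 0 <= p.1 /\ B (pS p.1 p.2)]) /\
  (forall tau, predictable_time F tau ->
     is_cond_exp (strict_past F tau) (at_finite S tau) (at_finite pS tau)).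

End processes.

Definition right_lower_semicontinuous (R : realType) (f : R -> R) : Prop :=
  forall t, 0 <= t -> forall a, a < f t -> \forall s \near t^'+, a < f s.

Definition left_lower_semicontinuous (R : realType) (f : R -> R) : Prop :=
  forall t, 0 < t -> forall a, a < f t -> \forall s \near t^'-, a < f s.

Section setting.
Context {R : realType} {O : completeMetricType R}.

Section basis.
Context {d : measure_display} {Omega : topMeasurableType d}.
Variables (P : probability Omega R) (F : R -> set (set Omega))
          (X : Omega -> skorokhod (cem O)).

Definition process_setting : Prop :=
  [/\ polish R Omega /\ completed_borel P,
      filtration F,
      right_continuous_filtration F,
      (forall N, P.-negligible N -> F 0 N) &
      continuous X /\
      adapted F (fun t w => X w t : borel (cem O))].

Definition lifetime (w : Omega) : \bar R :=
  ereal_inf [set t%:E | t in [set t | 0 <= t /\ X w t = cemetery]].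

Definition initial_law (nu : probability (borel O) R) : Prop :=
  forall B : set O, <<s @open O >> B ->
    P [set w | exists2 x, B x & X w 0 = alive x] = nu B.

Definition markov
    (p : R -> R.-pker (borel (cem O)) ~> (borel (cem O))) : Prop :=
  forall s t (B : set (borel (cem O))), 0 <= s -> 0 < t -> measurable B ->
    {ae P, forall w,
       cond_exp P (F s) (\1_[set w' | B (X w' (s + t))]) w =
       fine (p t (X w s) B)}.

Definition value_process (S : R -> Omega -> R) (psi : cem O -> R) (t : R)
    : Omega -> \bar R :=
  essential_sup P
    [set EFin \o cond_exp P (F t)
           (fun w => psi (X w (sigma w)) - S (sigma w) w)
     | sigma in stopping_time_after F t].

End basis.

Record process_basis := ProcessBasis {
  basis_display : measure_display ;
  basis_space : topMeasurableType basis_display ;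
  basis_prob : probability basis_space R ;
  basis_filtration : R -> set (set basis_space) ;
  basis_process : basis_space -> skorokhod (cem O) }.

Definition transition_semigroup
    (p : R -> R.-pker (borel (cem O)) ~> (borel (cem O))) : Prop :=
  forall s t (x : borel (cem O)) (B : set (borel (cem O))),
    0 < s -> s < t -> measurable B ->
    (p t x B = \int[p s x]_y p (t - s)%R y B)%E.

Definition feller_continuous
    (p : R -> R.-pker (borel (cem O)) ~> (borel (cem O))) : Prop :=
  forall f, Cb R (cem O) f -> forall e : R, 0 < e ->
    \forall t \near (0 : R)^'+, forall x : cem O,
      `|\int[p t x]_y f y - f x| < e.

(* [Z x] is the process started at [x], on its own filtered probability
   space. *)
Definition started_processes
    (p : R -> R.-pker (borel (cem O)) ~> (borel (cem O)))
    (Z : cem O -> process_basis) : Prop :=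
  forall x : cem O,
  let PZ := basis_prob (Z x) in
  let XZ := @basis_process (Z x) in
  [/\ process_setting PZ (@basis_filtration (Z x)) XZ,
      {ae PZ, forall w, XZ w 0 = x},
      (forall t (B : set (borel (cem O))), 0 < t -> measurable B ->
         PZ [set w | B (XZ w t)] = p t x B) &
      markov PZ (@basis_filtration (Z x)) XZ p].

Definition reduite (Z : cem O -> process_basis) (psi : cem O -> R)
    (x : cem O) : R :=
  sup [set (\int[basis_prob (Z x)]_w psi (basis_process w (sigma w)))%R
       | sigma in stopping_time (@basis_filtration (Z x))].

End setting.

(* Main.v *)
(** Write [v] for the réduite of [psi] and [psibar = psi - v <= 0].

    On the grid of mesh [2^-n], backward induction with [k] remaining steps,
    [max (psi, E psi_(k-1) (X_h))], gives functions whose supremum over [n] and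
    [k] is [v]: the optimal rule is to stop at the first contact with [psi], and
    every stopping time is a decreasing limit of grid times.  Hence [v] does not
    depend on the basis carrying the process, and [v (X)] is a supermartingale
    along all stopping times.  This gives one inequality.

    For the other one, let [sigma] be a stopping time after [t] and [tau] the
    first contact time on the grid.  Before [tau] the backward induction is a
    martingale, at [tau] it equals [psi], and [psibar <= 0]; since [- S] is a
    supermartingale, stopping at [min (sigma, tau)] yields, given [F_t], at least
    the [psibar]-gain of [sigma] plus the backward induction at [X_t].  Taking the
    supremum over the grids replaces the latter by [v (X_t)], so
    [G^psi - v (X)] is an essential supremum of the [psibar]-gains. *)

From HB Require Import structures.
From mathcomp Require Import all_boot all_order all_algebra.
From mathcomp Require Import all_classical all_reals all_analysis.
From mathcomp Require Import measurable_realfun.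
From mathcomp Require Import lra zify.
Require Import Defs.

Set Implicit Arguments.
Unset Strict Implicit.
Unset Printing Implicit Defensive.

Import Order.TTheory GRing.Theory Num.Theory.
Import numFieldNormedType.Exports.

Local Open Scope classical_set_scope.
Local Open Scope ring_scope.

(** * Conditional expectations and essential suprema *)

Section conditional_expectation.
Context {R : realType} {d : measure_display} {Omega : topMeasurableType d}.
Variable P : probability Omega R.
Variable G : set (set Omega).
Hypothesis sG : sigma_algebra setT G.
Hypothesis mG : G `<=` measurable.

(** As [G] is a sigma-algebra, [<<s G>>] is [G] itself; this gives access to the closure properties
    of measurable functions. *)
Lemma measurable_wrtP d' (T : measurableType d') (Y : Omega -> T) :
  measurable_wrt G Y <->
  measurable_fun setT (Y : g_sigma_algebraType G -> T).
Proof.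
have E : <<s G >> = G by exact: sigma_algebra_id.
split=> [mY _ B mB|mY B mB].
  by rewrite setTI; apply: sub_sigma_algebra; exact: mY.
by have := mY measurableT B mB; rewrite setTI /measurable/= E.
Qed.

Lemma measurable_wrt_measurable d' (T : measurableType d') (Y : Omega -> T) :
  measurable_wrt G Y -> measurable_fun setT Y.
Proof. by move=> mY _ B mB; rewrite setTI; apply/mG/mY. Qed.

Lemma measurable_wrtD (Y1 Y2 : Omega -> R) :
  measurable_wrt G Y1 -> measurable_wrt G Y2 ->
  measurable_wrt G (fun w => Y1 w + Y2 w).
Proof. by move=> m1 m2; apply/measurable_wrtP/measurable_funD; exact/measurable_wrtP. Qed.

(** Existence by Radon-Nikodym: the charge integrating [f] is pushed forward along the identity of
    [Omega], seen as a map onto the coarser measurable space of [G], and its density with respect to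
    the image of [P] is a conditional expectation. *)
Lemma is_cond_exp_cond_exp (f : Omega -> R) :
  P.-integrable setT (EFin \o f) -> is_cond_exp P G f (cond_exp P G f).
Proof.
move=> intf.
suff ex : exists Y, is_cond_exp P G f Y by exact: (xgetPex (cst 0) ex).
have E : <<s G >> = G by exact: sigma_algebra_id.
have mid : measurable_fun setT (id : Omega -> g_sigma_algebraType G).
  move=> _ B mB; rewrite setTI; apply: mG; move: mB; rewrite /measurable/= E; exact.
pose phi : {mfun Omega >-> g_sigma_algebraType G} := mfun_Sub (mem_set mid).
have mphi : measurable_fun setT phi by [].
have [nu nuE] : exists nu : {charge set (g_sigma_algebraType G) -> \bar R},
    nu = pushforward (induced_charge intf) phi :> (set _ -> _).
  by unshelve eexists (pushforward (induced_charge intf) phi).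
have dom : nu `<< pushforward P phi.
  rewrite nuE.
  apply: dominates_pushforward => //.
  apply/null_content_dominatesP => A mA PA.
  rewrite /= /induced_charge null_set_integral//.
    exact: measurable_funTS (measurable_int _ intf).
pose m : probability (g_sigma_algebraType G) R := distribution P phi.
pose g := Radon_Nikodym nu m.
have gfin x : g x \is a fin_num by exact: Radon_Nikodym_fin_num.
have intg : m.-integrable setT g by exact: Radon_Nikodym_integrable.
exists (fine \o g).
have gE : EFin \o (fine \o g) = g by apply/funext => x /=; rewrite fineK.
have mg : measurable_fun setT g by exact: measurable_int intg.
have mgphi : measurable_fun setT (g \o phi) by exact: measurableT_comp.
have intgphi : P.-integrable setT (g \o phi).
  apply/integrableP; split => //.
  have /integrableP[_] := intg; rewrite ge0_integral_pushforward//.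
  exact: measurableT_comp.
have intgP A : measurable A ->
    (\int[m]_(x in A) g x = \int[P]_(x in phi @^-1` A) (g \o phi) x)%E.
  move=> mA; apply: integral_pushforward => //.
  apply: (integrableS measurableT) => //.
  by rewrite -[X in measurable X]setTI; exact: mphi.
split.
- by apply/measurable_wrtP; exact: measurableT_comp.
- by rewrite (_ : _ \o _ = g \o phi).
- move=> A GA.
  have mA : measurable (A : set (g_sigma_algebraType G)).
    exact: sub_sigma_algebra.
  have -> : (\int[P]_(w in A) (f w)%:E)%E = nu A by rewrite nuE.
  rewrite (Radon_Nikodym_integral (mu := m))// -/g intgP//.
  by apply: eq_integral => x _; rewrite -[in RHS]gE.
Qed.

Lemma Rintegral_cond_exp (f : Omega -> R) A :
  P.-integrable setT (EFin \o f) -> G A ->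
  \int[P]_(w in A) cond_exp P G f w = \int[P]_(w in A) f w.
Proof.
by move=> intf GA; have [_ _ E] := is_cond_exp_cond_exp intf;
  rewrite /Rintegral E.
Qed.

(** The test event is [Y2 < Y1], which lies in [G]: there [Y1 - Y2] is positive with a nonpositive
    integral, so the event is null. *)
Lemma ae_le_measurable_wrt (Y1 Y2 : Omega -> R) :
  measurable_wrt G Y1 -> measurable_wrt G Y2 ->
  P.-integrable setT (EFin \o Y1) -> P.-integrable setT (EFin \o Y2) ->
  (forall A, G A -> \int[P]_(w in A) Y1 w <= \int[P]_(w in A) Y2 w) ->
  {ae P, forall w, Y1 w <= Y2 w}.
Proof.
move=> mY1 mY2 i1 i2 le12.
pose A := [set w | Y2 w < Y1 w].
have E : <<s G >> = G by exact: sigma_algebra_id.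
have GA : G A.
  have : measurable_fun setT
      ((fun w => Y2 w < Y1 w) : g_sigma_algebraType G -> bool).
    by apply: measurable_fun_ltr; exact/measurable_wrtP.
  by move=> /(_ measurableT [set true] I); rewrite setTI /measurable/= E.
have mA : measurable A by exact: mG.
have i1A : P.-integrable A (EFin \o Y1) by apply: (integrableS measurableT).
have i2A : P.-integrable A (EFin \o Y2) by apply: (integrableS measurableT).
pose h w := Y1 w - Y2 w.
have i12A : P.-integrable A (EFin \o h).
  exact: (integrableB mA i1A i2A).
have int0 : (\int[P]_(w in A) `|(EFin \o h) w| = 0)%E.
  rewrite (eq_integral (EFin \o h)); last first.
    by move=> w; rewrite inE => Aw; rewrite /= ger0_norm// subr_ge0 ltW.
  rewrite -[LHS]fineK; last exact: integrable_fin_num.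
  congr EFin; apply/eqP; rewrite eq_le; apply/andP; split.
    have := RintegralB mA i1A i2A; rewrite /Rintegral/= => ->.
    by rewrite subr_le0; exact: le12.
  by apply: Rintegral_ge0 => w Aw; rewrite subr_ge0 ltW.
have /ae_eq_integral_abs : measurable_fun A (EFin \o h).
  exact: measurable_int i12A.
move=> /(_ P mA) [/(_ int0) + _]; apply: filterS => w hw.
rewrite leNgt; apply/negP => Aw; have := hw Aw => /=.
by move=> [] /eqP; rewrite subr_eq0 => /eqP e; rewrite e ltxx in Aw.
Qed.

End conditional_expectation.

Section essential_supremum.
Context {R : realType} {d : measure_display} {Omega : topMeasurableType d}.
Variable P : probability Omega R.

Lemma ae_eq_of_Rintegral_le (f g : Omega -> R) :
  P.-integrable setT (EFin \o f) -> P.-integrable setT (EFin \o g) ->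
  (forall w, f w <= g w) -> \int[P]_w g w <= \int[P]_w f w ->
  {ae P, forall w, g w = f w}.
Proof.
move=> intf intg fg gf.
pose h w := g w - f w.
have inth : P.-integrable setT (EFin \o h) by exact: (integrableB measurableT intg intf).
have int0 : (\int[P]_w `|(EFin \o h) w| = 0)%E.
  rewrite (eq_integral (EFin \o h)); last first.
    by move=> w _; rewrite /= ger0_norm// subr_ge0.
  rewrite -[LHS]fineK; last exact: integrable_fin_num.
  congr EFin; apply/eqP; rewrite eq_le; apply/andP; split.
    have := RintegralB measurableT intg intf; rewrite /Rintegral/= => ->.
    by rewrite subr_le0.
  by apply: Rintegral_ge0 => w _; rewrite subr_ge0.
have /ae_eq_integral_abs : measurable_fun setT (EFin \o h).
  exact: measurable_int inth.
move=> /(_ P measurableT) [/(_ int0) + _]; apply: filterS => w /(_ I)[] /eqP.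
by rewrite subr_eq0 => /eqP.
Qed.

Variable H : set (Omega -> R).
Variables (y0 : Omega -> R) (K : R).
Hypothesis Hy0 : H y0.
Hypothesis inty0 : P.-integrable setT (EFin \o y0).
Hypothesis mH : forall y, H y -> measurable_fun setT y.
Hypothesis HK : forall y, H y -> {ae P, forall w, y w <= K}.

Let trunc (f : nat -> Omega -> R) n w := Num.min (f n w) K.
Let t (f : nat -> Omega -> R) w := sups (trunc f ^~ w) 0.

Let trunc_ub f w : has_ubound (range (trunc f ^~ w)).
Proof. by exists K => _ [n _ <-]; rewrite /trunc ge_min lexx orbT. Qed.

Let sdrop0 (u : nat -> R) : sdrop u 0 = range u.
Proof. by apply/seteqP; split => _ [n _ <-]; exists n. Qed.

Let trunc_le_t f n w : trunc f n w <= t f w.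
Proof. by rewrite /t /sups/= sdrop0; apply: ub_le_sup => //; exists n. Qed.

Let t_le f w c : (forall n, trunc f n w <= c) -> t f w <= c.
Proof.
move=> le_c; rewrite /t /sups/= sdrop0; apply: ge_sup.
  by exists (trunc f 0 w), 0%N.
by move=> _ [n _ <-].
Qed.

(** Starting every sequence at the integrable [y0] keeps [t f] between [Num.min (y0 w) K] and [K],
    hence integrable. *)
Let seqs := [set f : nat -> Omega -> R | f 0%N = y0 /\ forall n, H (f n)].

Let measurable_t f : seqs f -> measurable_fun setT (t f).
Proof.
move=> [_ Hf]; apply: measurable_fun_sups => // m.
by apply: measurable_minr => //; exact: mH.
Qed.

Let integrable_t f : seqs f -> P.-integrable setT (EFin \o t f).
Proof.
move=> sf; apply: (le_integrable measurableT _ (g := EFin \o (fun w => `|y0 w| + `|K|))).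
- by apply/measurable_EFinP; exact: measurable_t.
- move=> w _ /=; rewrite lee_fin [leRHS]ger0_norm ?addr_ge0//.
  have tK : t f w <= K by apply: t_le => n; rewrite /trunc ge_min lexx orbT.
  have yt : Num.min (y0 w) K <= t f w.
    by rewrite -sf.1; exact: trunc_le_t.
  have := ler_norm K; have := ler_norm (y0 w).
  have := ler_norm (- K); have := ler_norm (- y0 w); rewrite !normrN.
  by rewrite ler_norml; move: yt; case: (leP (y0 w) K) => *; lra.
- have : P.-integrable setT (EFin \o (fun w => `|y0 w|)) by exact: integrable_norm.
  move=> /(integrableD measurableT) h.
  by apply: (h (EFin \o cst `|K|)); exact: finite_measure_integrable_cst.
Qed.

Let t_le_Rintegral f g : seqs f -> seqs g -> (forall n, exists m, f n = g m) ->
  (forall w, t f w <= t g w) /\ \int[P]_w t f w <= \int[P]_w t g w.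
Proof.
move=> sf sg fg.
have tfg w : t f w <= t g w.
  apply: t_le => n; have [m fgm] := fg n.
  by apply: le_trans (trunc_le_t g m w); rewrite /trunc fgm.
by split => //; apply: le_Rintegral => //; exact: integrable_t.
Qed.

(* The supremum of a sequence in [H] with maximal integral is an essential
   supremum; truncating at [K] keeps suprema and integrals real. *)
Lemma is_ess_sup_ex :
  exists z : Omega -> R, is_ess_sup P [set EFin \o y | y in H] (EFin \o z).
Proof.
pose D := [set \int[P]_w t f w | f in seqs].
have D0 : D !=set0.
  by exists (\int[P]_w t (fun=> y0) w), (fun=> y0).
have ubD : has_ubound D.
  exists K => _ [f sf <-].
  have -> : K = \int[P]_w K.
    rewrite Rintegral_cst// [fine _](_ : _ = 1) ?mulr1//.
    by apply: (congr1 fine (y := 1%E)); exact: probability_setT.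
  apply: le_Rintegral => //; [exact: integrable_t| |].
    exact: finite_measure_integrable_cst.
  by move=> w _; apply: t_le => n; rewrite /trunc ge_min lexx orbT.
have : forall k : nat, exists f, seqs f /\ sup D - k.+1%:R^-1 < \int[P]_w t f w.
  move=> k; have [|_ [f sf <-] ltf] := @sup_adherent _ D k.+1%:R^-1 _ (conj D0 ubD).
    by rewrite invr_gt0.
  by exists f.
move=> /choice[F /all_and2[sF ltF]].
(* One sequence enumerating all [F k m] through pickled pairs, with [y0] in front and as default:
   [t g] dominates every [t (F k)], so its integral reaches [sup D]. *)
pose g n := if n is n'.+1 then
  if unpickle n' is Some (k, m) then F k m else y0 else y0.
have sg : seqs g.
  split=> // -[//|n] /=; case: unpickle => // -[k m].
  by have [_] := sF k; exact.
have Dg : sup D <= \int[P]_w t g w.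
  apply/ler_addgt0Pr => e e0.
  have [k ke] : exists k : nat, k.+1%:R^-1 < e.
    have [k _ /(_ k (leqnn k))] := near_infty_natSinv_lt (PosNum e0).
    by exists k.
  have := ltF k; have : \int[P]_w t (F k) w <= \int[P]_w t g w.
    apply: (t_le_Rintegral (sF k) sg _).2 => m.
    by exists (pickle (k, m)).+1; rewrite /g pickleK.
  move: (\int[P]_w t (F k) w) (\int[P]_w t g w) (sup D) k.+1%:R^-1 ke => a b c x.
  lra.
exists (t g); split.
- by apply/measurable_EFinP; exact: measurable_t.
- move=> _ [y Hy <-].
  (* [g'] is [y0], then [y], then all of [g], because a sequence must start at [y0]. Its supremum is
     at least [t g] while its integral cannot exceed [sup D], so the two agree almost everywhere; as
     [y <= K], truncation does not alter [y], which thus lies below [t g]. *)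
  pose g' n := if n is n'.+1 then if n' is n''.+1 then g n'' else y else y0.
  have sg' : seqs g'.
    by split=> // -[|[|n]]//=; have [_] := sg; exact.
  have [tgg' _] := t_le_Rintegral sg sg' (fun n => ex_intro _ n.+2 erefl).
  have : {ae P, forall w, t g' w = t g w}.
    apply: ae_eq_of_Rintegral_le => //; [exact: integrable_t..|].
    by apply: le_trans Dg; apply: ub_le_sup => //; exists g'.
  have := HK Hy; apply: filterS2 => w yK /= <-.
  rewrite lee_fin; apply: le_trans (trunc_le_t g' 1 w).
  by rewrite /trunc/= le_min lexx.
- move=> Z' mZ' HZ'.
  have : {ae P, forall w, forall n, ((g n w)%:E <= Z' w)%E}.
    apply: ae_foralln => n; apply: HZ'; exists (g n) => //.
    by have [_] := sg; exact.
  apply: filterS => w gZ.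
  case E : (Z' w) => [r| |]; last 2 first.
  + exact: leey.
  + by have := gZ 0%N; rewrite E.
  rewrite lee_fin; apply: t_le => n; rewrite /trunc ge_min.
  by have := gZ n; rewrite E lee_fin => ->.
Qed.

End essential_supremum.

Section essential_supremum_uniqueness.
Context {R : realType} {d : measure_display} {Omega : topMeasurableType d}.
Variable P : probability Omega R.

Lemma ae_eq_is_ess_sup (H : set (Omega -> \bar R)) (Z1 Z2 : Omega -> \bar R) :
  is_ess_sup P H Z1 -> is_ess_sup P H Z2 -> {ae P, forall w, Z1 w = Z2 w}.
Proof.
move=> [m1 ub1 lub1] [m2 ub2 lub2].
have := lub1 _ m2 ub2; have := lub2 _ m1 ub1.
by apply: filterS2 => w ? ?; apply/eqP; rewrite eq_le; apply/andP.
Qed.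

Lemma is_ess_sup_essential_sup (H : set (Omega -> \bar R)) (Z : Omega -> \bar R) :
  is_ess_sup P H Z -> is_ess_sup P H (essential_sup P H).
Proof. by move=> HZ; apply: (xgetPex (cst 0%E)); exists Z. Qed.

End essential_supremum_uniqueness.

(** * Bounded measurable functions *)

Section mixture.
Context {R : realType} {d d' : measure_display}.
Context {T : measurableType d} {Y : measurableType d'}.
Variables (m : {measure set T -> \bar R}) (k : R.-ker T ~> Y).
Variable nu : {measure set Y -> \bar R}.
Hypothesis nuE : forall B, measurable B -> nu B = (\int[m]_x k x B)%E.

Import HBNNSimple.
Local Open Scope ereal_scope.

Let integral_mixture_nnsfun (h : {nnsfun Y >-> R}) :
  \int[nu]_y (h y)%:E = \int[m]_x \int[k x]_y (h y)%:E.
Proof.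
rewrite integralT_nnsfun sintegralE.
under [RHS]eq_integral do rewrite integralT_nnsfun sintegralE.
have hk r x : 0 <= r%:E * k x (h @^-1` [set r]).
  by apply: (mulemu_ge0 (fun r => h @^-1` [set r])); exact: preimage_nnfun0.
have mk r : measurable_fun setT (fun x => k x (h @^-1` [set r])).
  exact: measurable_kernel.
rewrite ge0_integral_fsum//; last first.
  by move=> r; exact: measurable_funeM.
apply: eq_fsbigr => r _; rewrite nuE//.
(* A negative value [r] is not attained by [h], so both sides vanish. *)
have [r0|r0] := leP 0%R r; first by rewrite ge0_integralZl.
rewrite !integral0_eq ?mule0// => x _.
  by rewrite preimage_nnfun0// measure0 ?mule0.
by rewrite preimage_nnfun0// measure0.
Qed.

(** Both sides pass to the limit along simple functions by monotone convergence. This serves twice: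
    for Chapman-Kolmogorov and for the Markov property. *)
Lemma ge0_integral_mixture (f : Y -> \bar R) :
  measurable_fun setT f -> (forall y, 0 <= f y) ->
  \int[nu]_y f y = \int[m]_x \int[k x]_y f y.
Proof.
move=> mf f0.
pose h := nnsfun_approx measurableT mf.
have mh n : measurable_fun setT (EFin \o h n) by exact/measurable_EFinP.
have h0 n y : 0 <= (EFin \o h n) y by rewrite lee_fin.
have nd_h y : {homo (fun n => (EFin \o h n) y) : a b / (a <= b)%N >-> a <= b}.
  by move=> a b ab; rewrite lee_fin; exact/lefP/nd_nnsfun_approx.
have hf (l : {measure set Y -> \bar R}) :
    \int[l]_y f y = limn (fun n => \int[l]_y (h n y)%:E).
  rewrite -monotone_convergence//.
  - by apply: eq_integral => y _; apply/esym/cvg_lim => //; exact: cvg_nnsfun_approx.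
  - by move=> n y _; exact: h0.
  - by move=> y _; exact: nd_h.
rewrite hf; under [in LHS]eq_fun do rewrite integral_mixture_nnsfun.
rewrite -monotone_convergence//.
- by apply: eq_integral => x _; rewrite hf.
- move=> n; apply: measurable_fun_integral_kernel.
  + exact: measurable_kernel.
  + exact: h0.
  + exact: mh.
- by move=> n x _; apply: integral_ge0 => y _; exact: h0.
- move=> x _ a b ab; apply: ge0_le_integral => //.
  + by move=> y _; exact: h0.
  + exact: mh.
  + exact: mh.
  + by move=> y _; exact: nd_h.
Qed.

End mixture.

Section bounded_functions.
Context {R : realType} {d : measure_display} {T : measurableType d}.
Implicit Types (f g : T -> R) (M : R).

Definition bounded_measurable M f :=
  measurable_fun setT f /\ forall x, `|f x| <= M.

Lemma integrable_cst_finite (m : {measure set T -> \bar R}) (D : set T) c :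
  (m setT < +oo)%E -> measurable D -> m.-integrable D (EFin \o cst c).
Proof.
move=> mT mD; apply/integrableP; split; first exact/measurable_EFinP.
rewrite (eq_integral (cst `|c|%:E))// integral_cst//=.
rewrite lte_mul_pinfty// (le_lt_trans _ mT)//.
by apply: le_measure; rewrite ?inE.
Qed.

Lemma integrable_bounded_measurable (m : {measure set T -> \bar R}) (D : set T)
    M f :
  (m setT < +oo)%E -> measurable D -> bounded_measurable M f ->
  m.-integrable D (EFin \o f).
Proof.
move=> mT mD [mf fM].
apply: (le_integrable mD _ (g := EFin \o cst `|M|)).
- by apply/measurable_EFinP; exact: measurable_funTS.
- by move=> x _ /=; rewrite lee_fin normr_id (le_trans (fM x))// ler_norm.
- exact: integrable_cst_finite.
Qed.

Lemma bounded_measurableD M N f g :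
  bounded_measurable M f -> bounded_measurable N g ->
  bounded_measurable (M + N) (fun x => f x + g x).
Proof.
move=> [mf fM] [mg gN]; split; first exact: measurable_funD.
by move=> x; rewrite (le_trans (ler_normD _ _))// lerD.
Qed.

Lemma bounded_measurableN M f :
  bounded_measurable M f -> bounded_measurable M (fun x => - f x).
Proof.
move=> [mf fM]; split; first exact: measurableT_comp.
by move=> x; rewrite normrN.
Qed.

Lemma bounded_measurable_max M f g :
  bounded_measurable M f -> bounded_measurable M g ->
  bounded_measurable M (fun x => Num.max (f x) (g x)).
Proof.
move=> [mf fM] [mg gN]; split; first exact: measurable_maxr.
by move=> x; case: (leP (f x) (g x)).
Qed.

Lemma RintegralN (m : {measure set T -> \bar R}) (D : set T) f :
  measurable D -> m.-integrable D (EFin \o f) ->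
  \int[m]_(x in D) (- f x) = - \int[m]_(x in D) f x.
Proof.
by move=> mD intf; rewrite -mulN1r -RintegralZl//;
  apply: eq_Rintegral => x _; rewrite mulN1r.
Qed.

Lemma ae_le_Rintegral (m : {measure set T -> \bar R}) (D : set T) f g :
  measurable D -> m.-integrable D (EFin \o f) -> m.-integrable D (EFin \o g) ->
  {ae m, forall x, f x <= g x} ->
  \int[m]_(x in D) f x <= \int[m]_(x in D) g x.
Proof.
move=> mD intf intg fg; rewrite -subr_ge0 -RintegralB//.
rewrite (_ : \int[m]_(x in D) (g x - f x) = \int[m]_(x in D) `|g x - f x|).
  exact: Rintegral_ge0.
have intB : m.-integrable D (EFin \o (fun x => g x - f x)).
  exact: (integrableB mD intg intf).
congr fine; apply: ae_eq_integral => //.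
- exact: measurable_int intB.
- by have /measurable_int := integrable_norm intB.
- by apply: filterS fg => x fgx _; rewrite ger0_norm// subr_ge0.
Qed.

(** Adding the bound [M] makes a bounded integrand nonnegative, so that [ge0_integral_mixture]
    applies; this identity removes the shift afterwards. *)
Lemma Rintegral_bounded_shift (m : {measure set T -> \bar R}) (D : set T) M f :
  (m setT < +oo)%E -> measurable D -> bounded_measurable M f ->
  (\int[m]_(x in D) (f x + M)%:E =
   (\int[m]_(x in D) f x + M * fine (m D))%:E)%E.
Proof.
move=> mT mD bf.
have bM : bounded_measurable `|M| (cst M : T -> R) by split.
have i1 := integrable_bounded_measurable mT mD bf.
have i2 := integrable_bounded_measurable mT mD bM.
rewrite -[LHS]fineK; last first.
  exact: (integrable_fin_num mD (integrableD mD i1 i2)).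
congr EFin; rewrite -[LHS]/(\int[m]_(x in D) (f x + M)).
by rewrite RintegralD// Rintegral_cst.
Qed.

Lemma ge0_integral_mrestr (m : {measure set T -> \bar R}) (D : set T)
    (mD : measurable D) (f : T -> \bar R) :
  measurable_fun setT f -> (forall x, 0 <= f x)%E ->
  (\int[mrestr m mD]_x f x = \int[m]_(x in D) f x)%E.
Proof.
move=> mf f0.
rewrite (@ge0_negligible_integral _ _ _ _ setT (~` D))//.
- rewrite setTD setCK; apply: eq_measure_integral => A mA AD.
  by rewrite /= /mrestr setIidl.
- exact: measurableC.
- rewrite /= /mrestr -[RHS](measure0 m); congr (m _); exact: setICl.
Qed.

(** Bounded convergence. The limit inherits measurability and the bound [M], which is how [v] and
    the functions evaluated at stopping times acquire theirs. *)
Lemma cvg_Rintegral_bounded (m : {measure set T -> \bar R}) (D : set T) M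
    (u : nat -> T -> R) f :
  (m setT < +oo)%E -> measurable D -> (forall n, bounded_measurable M (u n)) ->
  (forall x, u ^~ x @ \oo --> f x) ->
  bounded_measurable M f /\
  (\int[m]_(x in D) u n x) @[n --> \oo] --> \int[m]_(x in D) f x.
Proof.
move=> mT mD bu uf.
have mf : measurable_fun setT f.
  by apply: (@measurable_fun_cvg _ _ _ setT u) => // n; have [] := bu n.
have bf : bounded_measurable M f.
  split=> // x.
  have uM : \forall n \near \oo, [set y | y <= M] `|u n x|.
    by apply: nearW => n; have [_] := bu n; exact.
  exact: (closed_cvg _ (@closed_le _ M) uM _ (cvg_norm (uf x))).
split=> //.
have := @dominated_convergence _ T R m D mD
  (fun n => EFin \o u n) (EFin \o f) (EFin \o cst `|M|).
move=> [|||||_ _ h].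
- by move=> n; apply/measurable_EFinP/measurable_funTS; have [] := bu n.
- by apply/measurable_EFinP/measurable_funTS; have [] := bf.
- by apply: aeW => x _; apply: cvg_EFin; [exact: nearW|exact: uf].
- exact: integrable_cst_finite.
- apply: aeW => x n _ /=; rewrite lee_fin; have [_ /(_ x) h] := bu n.
  exact: le_trans (ler_norm M).
- move: h; rewrite /= -[X in _ --> X](fineK (integrable_fin_num mD
    (integrable_bounded_measurable mT mD bf))).
  exact: fine_cvg.
Qed.

End bounded_functions.

(** * Dynamic programming for the transition operator *)

Section transition_operator.
Context {R : realType} {O : completeMetricType R}.
Local Notation E := (borel (cem O)).
Variable p : R -> R.-pker E ~> E.
Implicit Types (f g : cem O -> R) (h M : R).

Definition expectation h f (x : cem O) : R := \int[p h x]_y f y.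

Lemma kernel_lty h x : (p h x [set: E] < +oo)%E.
Proof. by rewrite prob_kernel ltry. Qed.

Lemma ge0_expectation h f M x : bounded_measurable M (f : E -> R) ->
  (\int[p h x]_y (f y + M)%:E = (expectation h f x + M)%:E)%E.
Proof.
move=> bf; rewrite Rintegral_bounded_shift//; last exact: kernel_lty.
by rewrite prob_kernel mulr1.
Qed.

Lemma bounded_ge0 M f x : bounded_measurable M (f : E -> R) -> 0 <= f x + M.
Proof.
by move=> [_ /(_ x)]; rewrite ler_norml -lerBlDr sub0r => /andP[].
Qed.

Lemma le_expectation h f g M x :
  bounded_measurable M (f : E -> R) -> bounded_measurable M (g : E -> R) ->
  (forall y, f y <= g y) -> expectation h f x <= expectation h g x.
Proof.
move=> bf bg fg; apply: le_Rintegral => //.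
- exact: integrable_bounded_measurable (kernel_lty h x) measurableT bf.
- exact: integrable_bounded_measurable (kernel_lty h x) measurableT bg.
Qed.

Lemma expectation_cst h c x : expectation h (cst c) x = c.
Proof. by rewrite /expectation Rintegral_cst// prob_kernel mulr1. Qed.

Lemma expectationN h f M x : bounded_measurable M (f : E -> R) ->
  expectation h (fun y => - f y) x = - expectation h f x.
Proof.
move=> bf; apply: RintegralN => //.
exact: integrable_bounded_measurable (kernel_lty h x) measurableT bf.
Qed.

Lemma bounded_measurable_expectation h f M :
  bounded_measurable M (f : E -> R) ->
  bounded_measurable M (expectation h f : E -> R).
Proof.
move=> bf; split.
- have mg : measurable_fun setT (fun x : E => \int[p h x]_y (f y + M)%:E)%E.
    apply: measurable_fun_integral_kernel.
    + exact: measurable_kernel.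
    + by move=> y; rewrite lee_fin; exact: bounded_ge0.
    + by apply/measurable_EFinP; apply: measurable_funD => //; have [] := bf.
  have -> : expectation h f =
      (fun x => fine (\int[p h x]_y (f y + M)%:E)%E - M).
    by apply/funext => x; rewrite ge0_expectation//= addrK.
  by apply: measurable_funB => //; exact: measurableT_comp.
- move=> x; have M0 : 0 <= M by have [_ /(_ x)] := bf; exact: le_trans.
  have bM c : `|c| <= M -> bounded_measurable M (cst c : E -> R) by split.
  rewrite ler_norml; apply/andP; split.
    rewrite -[leLHS](expectation_cst h _ x); apply: (@le_expectation _ _ _ M) => //.
      by apply: bM; rewrite normrN ger0_norm.
    by move=> y; have [_ /(_ y)] := bf; rewrite ler_norml => /andP[].
  rewrite -[leRHS](expectation_cst h _ x); apply: (@le_expectation _ _ _ M) => //.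
    by apply: bM; rewrite ger0_norm.
  by move=> y; have [_ /(_ y)] := bf; rewrite ler_norml => /andP[].
Qed.

(** Chapman-Kolmogorov makes [p t x] the mixture of the kernel [p (t - s)] under [p s x]; this is
    applied to [f + M], which is nonnegative. *)
Lemma expectation_semigroup (sg : transition_semigroup p) s t f M x :
  0 < s -> s < t -> bounded_measurable M (f : E -> R) ->
  expectation t f x = expectation s (expectation (t - s) f) x.
Proof.
move=> s0 st bf.
have bg := bounded_measurable_expectation (t - s) bf.
apply: (@addIr _ M); apply: EFin_inj.
rewrite -(ge0_expectation t x bf) -(ge0_expectation s x bg).
rewrite (@ge0_integral_mixture _ _ _ _ _ (p s x) (p (t - s)) (p t x)).
- by apply: eq_integral => y _; rewrite ge0_expectation.
- by move=> B mB; exact: sg.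
- by apply/measurable_EFinP; apply: measurable_funD => //; have [] := bf.
- by move=> y; rewrite lee_fin; exact: bounded_ge0.
Qed.

Fixpoint dynprog h (psi : cem O -> R) (k : nat) (x : cem O) : R :=
  if k is k'.+1 then Num.max (psi x) (expectation h (dynprog h psi k') x)
  else psi x.

Section dynprog.
Variables (psi : cem O -> R) (M : R).
Hypothesis bpsi : bounded_measurable M (psi : E -> R).

Lemma bounded_measurable_dynprog h k :
  bounded_measurable M (dynprog h psi k : E -> R).
Proof.
elim: k => [//|k IH] /=; apply: bounded_measurable_max => //.
exact: bounded_measurable_expectation.
Qed.

Lemma dynprog_ge h k x : psi x <= dynprog h psi k x.
Proof. by case: k => //= k; rewrite le_max lexx. Qed.

Lemma expectation_dynprog h k x :
  expectation h (dynprog h psi k) x <= dynprog h psi k.+1 x.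
Proof. by rewrite /= le_max lexx orbT. Qed.

Lemma le_dynprogS h k x : dynprog h psi k x <= dynprog h psi k.+1 x.
Proof.
elim: k x => [|k IH] x; first exact: dynprog_ge.
rewrite [leLHS]/= ge_max dynprog_ge andTb.
apply: (le_trans _ (expectation_dynprog _ _ _)).
by apply: (@le_expectation _ _ _ M) => //; exact: bounded_measurable_dynprog.
Qed.

Lemma le_dynprog h k l x : (k <= l)%N -> dynprog h psi k x <= dynprog h psi l x.
Proof.
move=> /subnK <-; elim: (l - k)%N => [//|j IH].
by rewrite addSn; apply: le_trans IH (le_dynprogS _ _ _).
Qed.

Hypothesis sg : transition_semigroup p.

(** Letting [j.+1] steps pass without stopping is one of the strategies. The count starts at one
    step because the semigroup law concerns positive times only. *)
Lemma expectation_iter h k j x : 0 < h ->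
  expectation (h *+ j.+1) (dynprog h psi k) x <= dynprog h psi (k + j.+1) x.
Proof.
move=> h0; elim: j x => [|j IH] x.
  by rewrite mulr1n addn1; exact: expectation_dynprog.
have hh : h < h *+ j.+2 by rewrite -[ltLHS]mulr1n ltr_pMn2l.
rewrite (expectation_semigroup sg x h0 hh (bounded_measurable_dynprog h k)).
rewrite [h *+ j.+2]mulrS addrAC subrr add0r addnS.
apply: (le_trans _ (expectation_dynprog _ _ _)).
apply: (@le_expectation _ _ _ M); [|exact: bounded_measurable_dynprog|exact: IH].
exact/bounded_measurable_expectation/bounded_measurable_dynprog.
Qed.

(** After halving the mesh and doubling the number of steps, all former stopping dates remain
    available. *)
Lemma dynprog_half h k x : 0 < h ->
  dynprog (h *+ 2) psi k x <= dynprog h psi k.*2 x.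
Proof.
move=> h0; elim: k x => [//|k IH] x.
rewrite [leLHS]/= -/(dynprog _ _ _ _) ge_max dynprog_ge andTb.
have := expectation_iter k.*2 1 x h0; rewrite addn2 -doubleS; apply: le_trans.
by apply: (@le_expectation _ _ _ M) => //; exact: bounded_measurable_dynprog.
Qed.

Definition mesh (n : nat) : R := (2 ^+ n)^-1.

Lemma mesh_gt0 n : 0 < mesh n.
Proof. by rewrite invr_gt0 exprn_gt0. Qed.

Lemma meshM n m : mesh m = mesh (m + n) *+ 2 ^ n.
Proof.
by rewrite /mesh -[RHS]mulr_natr natrX exprD invfM -mulrA mulVf ?mulr1//.
Qed.

Lemma le_dynprog_mesh n m k x :
  dynprog (mesh n) psi k x <= dynprog (mesh (n + m)) psi (k * 2 ^ m) x.
Proof.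
elim: m => [|m IH]; first by rewrite addn0 muln1.
apply: le_trans IH _; rewrite (meshM 1 (n + m)) expn1 expnS mulnCA mul2n addn1 addnS.
exact/dynprog_half/mesh_gt0.
Qed.

(** [v] enters only as the supremum over all meshes and horizons; the réduite is shown later to have
    this property, on bases of its own. *)
Variable v : cem O -> R.
Hypothesis v_ub : forall n k x, dynprog (mesh n) psi k x <= v x.
Hypothesis v_lub : forall x c,
  (forall n k, dynprog (mesh n) psi k x <= c) -> v x <= c.

(** Diagonal sequence with horizon [n] and mesh [2^-n]: it is nondecreasing and absorbs every pair
    of mesh and step count, hence tends to [v]. *)
Let w n := dynprog (mesh n) psi (n * 2 ^ n).

Let w_nd x m n : (m <= n)%N -> w m x <= w n x.
Proof.
move=> mn; apply: le_trans (le_dynprog_mesh m (n - m) _ _) _; rewrite subnKC//.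
by apply: le_dynprog; rewrite -mulnA -expnD subnKC// leq_mul2r mn orbT.
Qed.

Let cvg_w x : w ^~ x @ \oo --> v x.
Proof.
have -> : v x = sup (range (w ^~ x)).
  apply/eqP; rewrite eq_le; apply/andP; split; last first.
    by apply: ge_sup; [exists (w 0 x), 0%N|move=> _ [n _ <-]; exact: v_ub].
  (* Refining [k] times turns [k] steps of size [mesh n] into [k * 2 ^ k] steps of size
     [mesh (n + k)], at most as many as [w (n + k)] has. *)
  apply: v_lub => n k; apply: le_trans (le_dynprog_mesh n k k x) _.
  apply: (le_trans _ (ub_le_sup _ _)); last by exists (n + k)%N.
    apply: le_dynprog; rewrite leq_mul// ?leq_addl// leq_exp2l// leq_addl//.
  by exists (v x) => _ [i _ <-]; exact: v_ub.
apply: nondecreasing_cvgn => [m n mn|]; first exact: w_nd.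
by exists (v x) => _ [i _ <-]; exact: v_ub.
Qed.

(** For [n >= m] a step [mesh m] is made of [2 ^ (n - m)] steps [mesh n], so the expectation of
    [w n] after it is at most [v x]; then [n] tends to infinity. *)
Lemma expectation_sup_dynprog m x : expectation (mesh m) v x <= v x.
Proof.
have bw n : bounded_measurable M (w n : E -> R) by exact: bounded_measurable_dynprog.
have [_ h] := cvg_Rintegral_bounded (kernel_lty (mesh m) x) measurableT bw cvg_w.
apply: (closed_cvg _ (@closed_le _ (v x)) _ _ h).
exists m => // n /= mn.
rewrite -/(expectation _ _ _) -(subnKC mn) (meshM (n - m) m) subnKC//.
case E : (2 ^ (n - m))%N => [|j]; first by move: (expn_gt0 2 (n - m)); rewrite E.
exact: le_trans (expectation_iter _ _ _ (mesh_gt0 _)) (v_ub _ _ _).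
Qed.

Lemma bounded_measurable_sup_dynprog : bounded_measurable M (v : E -> R).
Proof.
have bw n : bounded_measurable M (w n : E -> R) by exact: bounded_measurable_dynprog.
(* Any finite measure would do here, as only the bound and the measurability of the limit are
   kept. *)
by have [] := cvg_Rintegral_bounded (kernel_lty 0 point) measurableT bw cvg_w.
Qed.

End dynprog.
End transition_operator.

(** * Optional sampling on a grid *)

Section markov_process.
Context {R : realType} {O : completeMetricType R}.
Local Notation E := (borel (cem O)).
Variable p : R -> R.-pker E ~> E.
Context {d : measure_display} {Omega : topMeasurableType d}.
Variables (P : probability Omega R) (F : R -> set (set Omega)).
Variable X : Omega -> skorokhod (cem O).
Hypothesis filF : filtration F.
Hypothesis adX : adapted F (fun t w => X w t : E).
Hypothesis mkX : markov P F X p.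

Lemma prob_lty : (P setT < +oo)%E.
Proof. by rewrite (le_lt_trans (probability_le1 _ _))// ltry. Qed.

Lemma measurable_filtration t A : 0 <= t -> F t A -> measurable A.
Proof. by move=> t0; case: filF => _ + _; exact. Qed.

Lemma filtration_le s t A : 0 <= s -> s <= t -> F s A -> F t A.
Proof. by move=> s0 st; case: filF => _ _; exact. Qed.

Lemma filtrationT t : 0 <= t -> F t setT.
Proof.
move=> t0; have [sF _ _] := filF; have [F0 FC _] := sF t t0.
by rewrite -(setD0 setT); exact: FC.
Qed.

Lemma filtrationC t A : 0 <= t -> F t A -> F t (~` A).
Proof.
move=> t0 FA; have [sF _ _] := filF; have [_ FC _] := sF t t0.
by rewrite -setTD; exact: FC.
Qed.

Lemma filtration_bigcup t (A : nat -> set Omega) : 0 <= t ->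
  (forall n, F t (A n)) -> F t (\bigcup_n A n).
Proof.
by move=> t0 FA; have [sF _ _] := filF; have [_ _ FU] := sF t t0; exact: FU.
Qed.

Lemma filtration0 t : 0 <= t -> F t set0.
Proof. by move=> t0; have [sF _ _] := filF; have [] := sF t t0. Qed.

Lemma filtrationU t A B : 0 <= t -> F t A -> F t B -> F t (A `|` B).
Proof.
move=> t0 FA FB; rewrite -bigcup2E; apply: filtration_bigcup => // -[|[|n]] //=.
exact: filtration0.
Qed.

Lemma filtrationI t A B : 0 <= t -> F t A -> F t B -> F t (A `&` B).
Proof.
move=> t0 FA FB; rewrite -[A `&` B]setCK setCI.
by apply: filtrationC => //; apply: filtrationU => //; exact: filtrationC.
Qed.

Lemma measurable_process t : 0 <= t -> measurable_fun setT (fun w => X w t : E).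
Proof.
move=> t0 _ B mB; rewrite setTI; apply: (measurable_filtration t0).
exact: adX.
Qed.

Lemma bounded_measurable_process t (f : cem O -> R) M : 0 <= t ->
  bounded_measurable M (f : E -> R) ->
  bounded_measurable M (fun w => f (X w t)).
Proof.
move=> t0 [mf fM]; split=> // ; rewrite -/(f \o (fun w => X w t)).
exact: measurableT_comp mf (measurable_process t0).
Qed.

(** The law of [X] at [s + h] on [A] is the mixture of [p h] under the law of [X] at [s] on [A]: for
    indicators this is the Markov property integrated over [A], and [ge0_integral_mixture] carries
    it over to [f + M]. *)
Lemma Rintegral_markov s h A (f : cem O -> R) M : 0 <= s -> 0 < h -> F s A ->
  bounded_measurable M (f : E -> R) ->
  \int[P]_(w in A) f (X w (s + h)) =
  \int[P]_(w in A) expectation p h f (X w s).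
Proof.
move=> s0 h0 FA bf; have mA := measurable_filtration s0 FA.
have sh0 : 0 <= s + h by rewrite addr_ge0// ltW.
have bg := bounded_measurable_expectation p h bf.
have shift t g : 0 <= t -> bounded_measurable M (g : E -> R) ->
    ((\int[P]_(w in A) g (X w t) + M * fine (P A))%:E =
     \int[P]_(w in A) (g (X w t) + M)%:E)%E.
  move=> t0 bg'; rewrite Rintegral_bounded_shift//; first exact: prob_lty.
  exact: bounded_measurable_process.
apply: (@addIr _ (M * fine (P A))); apply: EFin_inj; rewrite !shift//.
have mX t : 0 <= t -> measurable_fun setT (fun w => X w t : E).
  exact: measurable_process.
pose X1 : {mfun Omega >-> E} := mfun_Sub (mem_set (mX _ s0)).
pose X2 : {mfun Omega >-> E} := mfun_Sub (mem_set (mX _ sh0)).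
have tr (Y : {mfun Omega >-> E}) (g : E -> \bar R) :
    measurable_fun setT g -> (forall y, 0 <= g y)%E ->
    (\int[pushforward (mrestr P mA) Y]_y g y = \int[P]_(w in A) g (Y w))%E.
  move=> mg g0; rewrite ge0_integral_pushforward//.
  rewrite preimage_setT ge0_integral_mrestr//; first exact: (measurableT_comp mg).
  by move=> w; exact: g0.
have mfM g : bounded_measurable M (g : E -> R) ->
    measurable_fun setT (fun y : E => (g y + M)%:E).
  by move=> [mg _]; apply/measurable_EFinP; exact: measurable_funD.
have f0 g y : bounded_measurable M (g : E -> R) -> (0 <= (g y + M)%:E)%E.
  by move=> bg'; rewrite lee_fin; exact: bounded_ge0.
rewrite -(tr X2 (fun y => (f y + M)%:E)); [|exact: mfM|by move=> y; exact: f0].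
rewrite -(tr X1 (fun y => (expectation p h f y + M)%:E)); last 2 first.
  exact: mfM.
  by move=> y; exact: f0.
rewrite (@ge0_integral_mixture _ _ _ _ _ (pushforward (mrestr P mA) X1) (p h)).
- by apply: eq_integral => y _; rewrite ge0_expectation.
- move=> B mB; rewrite tr; [|exact: measurable_kernel|by []].
  have mXB : measurable (X2 @^-1` B).
    by rewrite -[_ @^-1` _]setTI; exact: (measurable_process sh0).
  have iB : P.-integrable setT (EFin \o (\1_(X2 @^-1` B) : Omega -> R)).
    exact: integrable_indic.
  have [sF mF _] := filF.
  have [mC iC EC] := is_cond_exp_cond_exp (sF s s0) (mF s s0) iB.
  transitivity (\int[P]_(w in A) (\1_(X2 @^-1` B) w)%:E)%E.
    by rewrite integral_indic.
  rewrite -EC//.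
  apply: ae_eq_integral => //.
  + exact: measurable_funTS (measurable_int _ iC).
  + apply: measurable_funTS.
    by apply: (@measurableT_comp _ _ _ _ _ _ (fun x => p h x B)) => //;
      exact: measurable_kernel.
  + have := mkX s0 h0 mB; apply: filterS => w ew _.
    rewrite [X in X%:E]ew fineK//.
    rewrite ge0_fin_numE// (le_lt_trans _ (kernel_lty p h (X w s)))//.
    by apply: le_measure; rewrite ?inE.
- exact: mfM.
- by move=> y; exact: f0.
Qed.

Section grid.
Variables t h : R.
Hypotheses (t0 : 0 <= t) (h0 : 0 < h).

Definition grid (j : nat) : R := t + h *+ j.

Lemma grid_ge j : t <= grid j.
Proof. by rewrite lerDl mulrn_wge0// ltW. Qed.

Lemma grid_ge0 j : 0 <= grid j.
Proof. exact: le_trans (grid_ge j). Qed.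

Lemma gridS j : grid j.+1 = grid j + h.
Proof. by rewrite /grid mulrSr addrA. Qed.

Lemma ler_grid i j : (grid i <= grid j) = (i <= j)%N.
Proof. by rewrite /grid lerD2l ler_pMn2l. Qed.

Definition stopping_index (a : Omega -> nat) :=
  forall j, F (grid j) [set w | (a w <= j)%N].

Lemma stopping_index_measurable a j : stopping_index a ->
  measurable [set w | a w = j].
Proof.
move=> Fa; have mle i : measurable [set w | (a w <= i)%N].
  exact: measurable_filtration (grid_ge0 i) (Fa i).
case: j => [|j].
  rewrite (_ : [set w | a w = 0%N] = [set w | (a w <= 0)%N])//.
  by apply/seteqP; split => w /=; rewrite leqn0 => /eqP.
rewrite (_ : [set w | a w = j.+1] =
  [set w | (a w <= j.+1)%N] `\` [set w | (a w <= j)%N]).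
  exact: measurableD.
apply/seteqP; split => w /=; first by move=> ->; rewrite ltnn.
by move=> [aj /negP]; rewrite -ltnNge => ja; apply/eqP; rewrite eqn_leq aj.
Qed.

Lemma stopping_index_cst j : stopping_index (cst j).
Proof.
move=> i; have [ji|ji] := leqP j i.
  by rewrite (_ : mkset _ = setT); [exact/filtrationT/grid_ge0|apply/seteqP].
rewrite (_ : mkset _ = set0); first exact/filtration0/grid_ge0.
by apply/seteqP; split => w //=; rewrite leqNgt ji.
Qed.

Lemma stopping_index_minn a b : stopping_index a -> stopping_index b ->
  stopping_index (fun w => minn (a w) (b w)).
Proof.
move=> Fa Fb j; rewrite (_ : mkset _ =
    [set w | (a w <= j)%N] `|` [set w | (b w <= j)%N]).
  by apply: filtrationU => //; exact: grid_ge0.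
by apply/seteqP; split => w /=; rewrite geq_min => /orP.
Qed.

Lemma stopping_index_maxn a b : stopping_index a -> stopping_index b ->
  stopping_index (fun w => maxn (a w) (b w)).
Proof.
move=> Fa Fb j; rewrite (_ : mkset _ =
    [set w | (a w <= j)%N] `&` [set w | (b w <= j)%N]).
  by apply: filtrationI => //; exact: grid_ge0.
by apply/seteqP; split => w /=; rewrite geq_max => /andP.
Qed.

(** The function may change with the step [j]: a dynamic program with [N - j] steps left needs this,
    while a fixed function is passed as [fun=> f]. *)
Definition sampled (u : nat -> cem O -> R) (a : Omega -> nat) (w : Omega) : R :=
  u (a w) (X w (grid (a w))).

Section sampled.
Variables (u : nat -> cem O -> R) (M : R).
Hypothesis bu : forall j, bounded_measurable M (u j : E -> R).

Lemma bounded_measurable_sampled a :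
  stopping_index a -> bounded_measurable M (sampled u a).
Proof.
move=> Fa; split; last by move=> w; have [_] := bu (a w); exact.
move=> _ B mB; rewrite setTI (_ : _ @^-1` _ = \bigcup_j ([set w | a w = j] `&`
    (fun w => u j (X w (grid j))) @^-1` B)).
  apply: bigcup_measurable => j _; apply: measurableI.
    exact: stopping_index_measurable.
  rewrite -[_ @^-1` _]setTI.
  by have [+ _] := bounded_measurable_process (grid_ge0 j) (bu j); exact.
apply/seteqP; split => [w Bw|w [j _ [/= <-]]//].
by exists (a w).
Qed.

(* Optional sampling: stop at [b] but not before [a], one grid step at a time. *)
Lemma le_Rintegral_sampled a b A :
  stopping_index a -> stopping_index b -> (forall w, (a w <= b w)%N) -> F t A ->
  (forall w j, (a w <= j < b w)%N ->
    expectation p h (u j.+1) (X w (grid j)) <= u j (X w (grid j))) ->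
  \int[P]_(w in A) sampled u b w <= \int[P]_(w in A) sampled u a w.
Proof.
move=> Fa Fb ab FA dec.
have mA : measurable A := measurable_filtration t0 FA.
pose c i w := minn (maxn (a w) i) (b w).
have Fc i : stopping_index (c i).
  apply: stopping_index_minn => //; apply: stopping_index_maxn => //.
  exact: stopping_index_cst.
have bc i := bounded_measurable_sampled (Fc i).
have int D f : measurable D -> bounded_measurable M f ->
    P.-integrable D (EFin \o f).
  by move=> mD bf; exact: integrable_bounded_measurable prob_lty mD bf.
have step i : \int[P]_(w in A) sampled u (c i.+1) w <=
    \int[P]_(w in A) sampled u (c i) w.
  (* On [B] the clock [c] moves from [i] to [i.+1]; elsewhere it stands still. Since [a <= i < b] is
     decided at time [grid i], the Markov property applies on [B]. *)
  pose B := A `&` [set w | (a w <= i < b w)%N].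
  have FB : F (grid i) B.
    apply: filtrationI; [exact: grid_ge0| |].
      exact: filtration_le (grid_ge i) FA.
    rewrite (_ : mkset _ = [set w | (a w <= i)%N] `&` ~` [set w | (b w <= i)%N]).
      apply: filtrationI; [exact: grid_ge0|exact: Fa|].
      by apply: filtrationC; [exact: grid_ge0|exact: Fb].
    apply/seteqP; split => w /=.
      by move=> /andP[? ib]; split => //; apply/negP; rewrite -ltnNge.
    by move=> [-> /negP]; rewrite -ltnNge.
  have mB := measurable_filtration (grid_ge0 i) FB.
  have BA : B `<=` A by move=> w [].
  have -> : A = B `|` (A `\` B) by rewrite setDUK.
  have mAB : measurable (A `\` B) by exact: measurableD.
  have dis : [disjoint B & A `\` B] by apply/disj_set2P; rewrite setDIK.
  rewrite !Rintegral_setU//; [|by apply: int => //; exact: measurableU..].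
  apply: lerD; last first.
    rewrite le_eqVlt (@eq_Rintegral _ _ _ P _ (sampled u (c i))) ?eqxx// => w.
    rewrite inE => -[Aw nB]; rewrite /sampled (_ : c i.+1 w = c i w)//.
    have : ~~ (a w <= i < b w)%N by apply/negP => iab; apply: nB.
    have := ab w; rewrite /c; case: (leqP (a w) i) => ai /=; lia.
  have cB w : w \in B -> (c i w = i) * (c i.+1 w = i.+1).
    by rewrite inE => -[_ /= /andP[ai ib]]; rewrite /c; split; lia.
  rewrite (@eq_Rintegral _ _ _ P _ (fun w => u i.+1 (X w (grid i + h)))); last first.
    by move=> w Bw; rewrite /sampled cB// gridS.
  rewrite [leRHS](@eq_Rintegral _ _ _ P _ (fun w => u i (X w (grid i)))); last first.
    by move=> w Bw; rewrite /sampled cB.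
  rewrite (Rintegral_markov (grid_ge0 i) h0 FB (bu i.+1)).
  apply: le_Rintegral => //.
  + apply: int => //; apply: bounded_measurable_process; first exact: grid_ge0.
    exact: bounded_measurable_expectation.
  + by apply: int => //; apply: bounded_measurable_process; first exact: grid_ge0.
  + by move=> w [_ /= aib]; exact: dec.
have c0 i : \int[P]_(w in A) sampled u (c i) w <=
    \int[P]_(w in A) sampled u a w.
  elim: i => [|i]; last exact/le_trans/step.
  rewrite le_eqVlt (@eq_Rintegral _ _ _ P _ (sampled u a)) ?eqxx// => w _.
  by rewrite /sampled (_ : c 0 w = a w)// /c maxn0; apply/minn_idPl.
(* At each [w] the clock reaches [b w] and stays there, so bounded convergence brings the chain of
   inequalities to [b]. *)
have cvg_c w : sampled u (c i) w @[i --> \oo] --> sampled u b w.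
  apply: cvg_near_cst; exists (b w) => // i /= bi.
  by rewrite /sampled (_ : c i w = b w)// /c; apply/minn_idPr; rewrite leq_max bi orbT.
have [_ cv] := cvg_Rintegral_bounded prob_lty mA bc cvg_c.
by apply: (closed_cvg _ (@closed_le _ _) _ _ cv); exact: nearW.
Qed.

End sampled.
End grid.
End markov_process.

(** * Stopping times and their approximation from the right on grids *)

Section stopping.
Context {R : realType} {O : completeMetricType R}.
Local Notation E := (borel (cem O)).
Variable p : R -> R.-pker E ~> E.
Context {d : measure_display} {Omega : topMeasurableType d}.
Variables (P : probability Omega R) (F : R -> set (set Omega)).
Variable X : Omega -> skorokhod (cem O).
Hypothesis filF : filtration F.
Hypothesis adX : adapted F (fun t w => X w t : E).
Hypothesis mkX : markov P F X p.
Variable t : R.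
Hypothesis t0 : 0 <= t.
Implicit Types (sigma rho : Omega -> R) (h s : R).

Lemma stopping_time_lt sigma s : stopping_time F sigma -> 0 <= s ->
  F s [set w | sigma w < s].
Proof.
move=> [sigma0 Fsigma] s0.
rewrite (_ : mkset _ = \bigcup_n [set w | sigma w <= s - n.+1%:R^-1]).
  apply: filtration_bigcup => // n.
  (* [F] is constrained at nonnegative times only; for a negative bound the event is empty since
     [sigma >= 0]. *)
  have [sn|sn] := leP 0 (s - n.+1%:R^-1).
    by apply: (filtration_le filF sn) (Fsigma _ sn); rewrite gerBl.
  rewrite (_ : mkset _ = set0); first exact: filtration0.
  by apply/seteqP; split => w //=; rewrite leNgt (lt_le_trans sn).
apply/seteqP; split => w /= => [sw|[n _ /= sw]]; last first.
  by rewrite (le_lt_trans sw)// ltrBlDr ltrDl invr_gt0.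
have e0 : 0 < s - sigma w by rewrite subr_gt0.
have [n _ /(_ n (leqnn n))] := near_infty_natSinv_lt (PosNum e0).
by move=> /= ne; exists n => //=; rewrite lerBrDl -lerBrDr ltW.
Qed.

Lemma stopping_time_after_min sigma rho :
  stopping_time_after F t sigma -> stopping_time_after F t rho ->
  stopping_time_after F t (fun w => Num.min (sigma w) (rho w)).
Proof.
move=> [[s0 Fs] ts] [[r0 Fr] tr]; split; last first.
  by move=> w; rewrite le_min ts tr.
split=> [w|s s_ge0]; first by rewrite le_min s0 r0.
rewrite (_ : mkset _ = [set w | sigma w <= s] `|` [set w | rho w <= s]).
  by apply: filtrationU => //; [exact: Fs|exact: Fr].
by apply/seteqP; split => w /=; rewrite ge_min => /orP.
Qed.

Lemma stopping_time_after_cst : stopping_time_after F t (cst t).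
Proof.
split=> //; split=> // s s0; have [ts|st] := leP t s.
  by rewrite (_ : mkset _ = setT); [exact: filtrationT|apply/seteqP; split].
rewrite (_ : mkset _ = set0); first exact: filtration0.
by apply/seteqP; split => w //=; rewrite leNgt st.
Qed.

(** The successor puts the grid time strictly after [sigma]: then the index is at most [j] exactly
    when [sigma < grid t h j], and the times approach [sigma] from the right, the side on which
    paths are continuous. *)
Definition grid_index h sigma (w : Omega) : nat :=
  (Num.truncn ((sigma w - t) / h)).+1.

Lemma grid_index_bounds h sigma w : 0 < h -> t <= sigma w ->
  sigma w < grid t h (grid_index h sigma w) <= sigma w + h.
Proof.
move=> h0 ts.
have /truncn_itv : 0 <= (sigma w - t) / h by rewrite divr_ge0 ?subr_ge0// ltW.
rewrite /grid_index /grid; move: (Num.truncn _) => k.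
rewrite ler_pdivlMr// ltr_pdivrMr// [h *+ _]mulrSr -[h *+ k]mulr_natl -natr1 mulrDl mul1r.
by move: (k%:R * h) => x; lra.
Qed.

Lemma grid_index_leq h sigma w j : 0 < h -> t <= sigma w ->
  (grid_index h sigma w <= j)%N = (sigma w < grid t h j).
Proof.
move=> h0 ts; rewrite /grid_index truncn_lt_nat; last first.
  by rewrite divr_ge0 ?subr_ge0// ltW.
by rewrite ltr_pdivrMr// mulr_natl ltrBlDl.
Qed.

Lemma le_grid_index h sigma rho w : 0 < h -> t <= sigma w ->
  sigma w <= rho w -> (grid_index h sigma w <= grid_index h rho w)%N.
Proof.
move=> h0 ts sr; rewrite grid_index_leq// (le_lt_trans sr)//.
by have /andP[] := grid_index_bounds h0 (le_trans ts sr).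
Qed.

Lemma stopping_index_grid_index h sigma : 0 < h ->
  stopping_time_after F t sigma -> stopping_index F t h (grid_index h sigma).
Proof.
move=> h0 [Fs ts] j.
rewrite (_ : mkset _ = [set w | sigma w < grid t h j]).
  by apply: stopping_time_lt => //; exact: grid_ge0.
by apply/seteqP; split => w /=; rewrite grid_index_leq.
Qed.

(** For [s >= t], let [k] be the last index with [grid t h k <= s]: having stopped by time [s] means
    [a <= k], which is known at [grid t h k]. *)
Lemma stopping_time_grid h a : 0 < h -> stopping_index F t h a ->
  stopping_time_after F t (fun w => grid t h (a w)).
Proof.
move=> h0 Fa; split=> [|w]; last exact: grid_ge.
split=> [w|s s0]; first exact: grid_ge0.
have [ts|st] := leP t s; last first.
  rewrite (_ : mkset _ = set0); first exact: filtration0.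
  by apply/seteqP; split => w //=; rewrite leNgt (lt_le_trans st)// grid_ge.
have /truncn_itv : 0 <= (s - t) / h by rewrite divr_ge0 ?subr_ge0// ltW.
set k := Num.truncn _; rewrite ler_pdivlMr// ltr_pdivrMr// !mulr_natl => /andP[ks sk].
rewrite (_ : mkset _ = [set w | (a w <= k)%N]).
  by apply: (filtration_le filF (grid_ge0 t0 h0 k)) (Fa k); rewrite -lerBrDl.
apply/seteqP; split => w /=.
  rewrite -ltnS -(ltr_pMn2l h0) => as_; apply: le_lt_trans sk.
  by rewrite lerBrDl.
by rewrite -(ler_grid t h0) => /le_trans; apply; rewrite -lerBrDl.
Qed.

Lemma cvg_mesh : (mesh n : R) @[n --> \oo] --> (0 : R).
Proof.
rewrite (_ : (fun n => _) = GRing.exp (2^-1 : R)); last first.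
  by apply/funext => n; rewrite exprVn.
by apply: cvg_expr; rewrite ger0_norm ?invf_lt1 ?ltr1n ?invr_ge0.
Qed.

Lemma cvg_path (f : cem O -> R) w (u : nat -> R) s : continuous f -> 0 <= s ->
  (forall n, s < u n) -> u @ \oo --> s ->
  f (X w (u n)) @[n --> \oo] --> f (X w s).
Proof.
move=> cf s0 su us.
have : (f \o X w) x @[x --> s^'+] --> f (X w s).
  exact: (continuous_cvg _ (cf (X w s)) (@path_right_continuous _ _ (X w) _ s0)).
by move/cvg_at_rightP; apply.
Qed.

Lemma cvg_grid_index sigma w : t <= sigma w ->
  grid t (mesh n) (grid_index (mesh n) sigma w) @[n --> \oo] --> sigma w.
Proof.
move=> ts; apply: (@squeeze_cvgr _ _ _ _ (cst (sigma w)) (fun n => sigma w + mesh n)).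
- apply: nearW => n; have := grid_index_bounds (mesh_gt0 n) ts.
  by move=> /andP[/ltW -> ->].
- exact: cvg_cst.
- by rewrite -[X in _ --> X]addr0; apply: cvgD; [exact: cvg_cst|exact: cvg_mesh].
Qed.

Section stopped.
Variables (f : cem O -> R) (M : R).
Hypotheses (cf : continuous f) (bf : bounded_measurable M (f : E -> R)).

Lemma bounded_measurable_approx sigma n : stopping_time_after F t sigma ->
  bounded_measurable M
    (sampled X t (mesh n) (fun=> f) (grid_index (mesh n) sigma)).
Proof.
move=> Fs; apply: (bounded_measurable_sampled filF adX t0 (mesh_gt0 n)) => //.
exact: stopping_index_grid_index (mesh_gt0 n) Fs.
Qed.

Lemma cvg_approx sigma w : stopping_time_after F t sigma ->
  sampled X t (mesh n) (fun=> f) (grid_index (mesh n) sigma) w @[n --> \oo]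
    --> f (X w (sigma w)).
Proof.
move=> [[s0 _] ts]; apply: cvg_path => //; last exact: cvg_grid_index.
by move=> n; have /andP[] := grid_index_bounds (mesh_gt0 n) (ts w).
Qed.

Lemma bounded_measurable_stopped sigma : stopping_time_after F t sigma ->
  bounded_measurable M (fun w => f (X w (sigma w))).
Proof.
move=> Fs; have [] // := cvg_Rintegral_bounded (prob_lty P) measurableT
  (fun n => bounded_measurable_approx n Fs) (fun w => @cvg_approx _ w Fs).
Qed.

(* A bounded continuous [f] with [expectation p h f <= f] for all dyadic [h] is
   excessive, so [f (X _)] is a supermartingale along stopping times. *)
Lemma le_Rintegral_stopped sigma rho A :
  (forall n x, expectation p (mesh n) f x <= f x) ->
  stopping_time_after F t sigma -> stopping_time_after F t rho ->
  (forall w, sigma w <= rho w) -> F t A ->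
  \int[P]_(w in A) f (X w (rho w)) <= \int[P]_(w in A) f (X w (sigma w)).
Proof.
move=> exc Fs Fr sr FA; have mA := measurable_filtration filF t0 FA.
have cv r : stopping_time_after F t r -> (\int[P]_(w in A)
      sampled X t (mesh n) (fun=> f) (grid_index (mesh n) r) w)
    @[n --> \oo] --> \int[P]_(w in A) f (X w (r w)).
  move=> Ft; have [] // := cvg_Rintegral_bounded (prob_lty P) mA
    (fun n => bounded_measurable_approx n Ft) (fun w => @cvg_approx _ w Ft).
have cs := cv _ Fs; have cr := cv _ Fr.
rewrite -(cvg_lim _ cs)// -(cvg_lim _ cr)//; apply: ler_lim.
- by apply/cvg_ex; eexists; exact: cr.
- by apply/cvg_ex; eexists; exact: cs.
apply: nearW => n.
apply: (le_Rintegral_sampled filF adX mkX t0 (mesh_gt0 n) (M := M)) => //.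
- exact: stopping_index_grid_index (mesh_gt0 n) Fs.
- exact: stopping_index_grid_index (mesh_gt0 n) Fr.
- by move=> w; apply: le_grid_index => //; [exact: mesh_gt0|exact: Fs.2].
Qed.

End stopped.

(** * First contact of the dynamic program with [psi] *)

Section first_contact.
Variables (h : R) (N : nat) (psi : cem O -> R) (M : R).
Hypotheses (h0 : 0 < h) (bpsi : bounded_measurable M (psi : E -> R)).

Definition contact w j :=
  dynprog p h psi (N - j) (X w (grid t h j)) == psi (X w (grid t h j)).

(** [find] returns [N] when no contact occurs earlier, and at [N] no step is left, so contact holds
    there in any case. *)
Definition first_contact w : nat := find (contact w) (iota 0 N).

Lemma first_contact_le w : (first_contact w <= N)%N.
Proof. by rewrite -[leqRHS](size_iota 0 N) find_size. Qed.

Lemma contact_first_contact w : contact w (first_contact w).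
Proof.
have [has_c|] := boolP (has (contact w) (iota 0 N)).
  have := nth_find 0%N has_c; rewrite nth_iota ?add0n//.
  by rewrite -[ltnRHS](size_iota 0 N) -has_find.
rewrite has_find -leqNgt size_iota => Nc.
have -> : first_contact w = N by apply/eqP; rewrite eqn_leq first_contact_le.
by rewrite /contact subnn.
Qed.

Lemma before_first_contact w j : (j < first_contact w)%N -> ~~ contact w j.
Proof.
move=> jc; have := before_find 0%N jc.
by rewrite nth_iota ?add0n// ?(leq_trans jc)// ?first_contact_le// => ->.
Qed.

Lemma stopping_index_first_contact : stopping_index F t h first_contact.
Proof.
move=> j.
rewrite (_ : mkset _ =
    \bigcup_i (if (i <= j)%N then [set w | contact w i] else set0)).
  apply: (filtration_bigcup filF (grid_ge0 t0 h0 j)) => i.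
  case: ifPn => [ij|_]; last exact: (filtration0 filF (grid_ge0 t0 h0 j)).
  have := ij; rewrite -(ler_grid t h0).
  move=> /(filtration_le filF (grid_ge0 t0 h0 i)); apply.
  have mB : measurable [set x : E | dynprog p h psi (N - i) x == psi x].
    have := measurable_fun_eqr (bounded_measurable_dynprog p bpsi h (N - i)).1
      bpsi.1.
    by move=> /(_ measurableT [set true] I); rewrite setTI.
  exact: adX (grid_ge0 t0 h0 i) _ mB.
apply/seteqP; split => w /=.
  by move=> fj; exists (first_contact w) => //=; rewrite fj; exact: contact_first_contact.
move=> [i _]; case: ifPn => //= ij ci; apply: leq_trans ij.
by rewrite leqNgt; apply/negP => /before_first_contact; rewrite ci.
Qed.

(** Before contact the dynamic program exceeds [psi], so it equals its one-step expectation.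
    Optional sampling is applied to its opposite, which bounds the stopped values from below. *)
Lemma Rintegral_first_contact b A : stopping_index F t h b -> F t A ->
  \int[P]_(w in A) dynprog p h psi N (X w t) <=
  \int[P]_(w in A) sampled X t h (fun j => dynprog p h psi (N - j))
    (fun w => minn (b w) (first_contact w)) w.
Proof.
move=> Fb FA; have mA := measurable_filtration filF t0 FA.
have bu k := bounded_measurable_dynprog p bpsi h k.
have Fc := stopping_index_minn filF t0 h0 Fb stopping_index_first_contact.
have F0 := stopping_index_cst filF t0 h0 0.
have int a : stopping_index F t h a -> P.-integrable A
    (EFin \o sampled X t h (fun j => dynprog p h psi (N - j)) a).
  move=> Fa; apply: (integrable_bounded_measurable (M := M) (prob_lty P) mA).
  exact: (bounded_measurable_sampled filF adX t0 h0 (fun j => bu (N - j)%N)).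
have IN a : stopping_index F t h a ->
    \int[P]_(w in A) sampled X t h (fun j x => - dynprog p h psi (N - j) x) a w =
    - \int[P]_(w in A) sampled X t h (fun j => dynprog p h psi (N - j)) a w.
  by move=> /int ia; rewrite -RintegralN.
rewrite -[leRHS]opprK -IN// lerNr.
have -> : \int[P]_(w in A) dynprog p h psi N (X w t) =
    \int[P]_(w in A) sampled X t h (fun j => dynprog p h psi (N - j)) (cst 0%N) w.
  by apply: eq_Rintegral => w _; rewrite /sampled /= subn0 /grid mulr0n addr0.
rewrite -IN//; apply: (le_Rintegral_sampled filF adX mkX t0 h0 (M := M)) => //.
  by move=> j; exact: bounded_measurableN.
move=> w j /andP[_]; rewrite leq_min => /andP[_ jc].
have jN : (j < N)%N by apply: leq_trans (first_contact_le w).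
rewrite (expectationN p h _ (bu _)) lerN2.
have := before_first_contact jc; rewrite /contact -(subnSK jN) /= maxEle.
by case: ifP => //; rewrite eqxx.
Qed.

(** With one step fewer left at each date, the dynamic program is a supermartingale under any rule;
    [b <= N] keeps the subtraction [N - j] from being cut at zero. *)
Lemma Rintegral_dynprog_ge b A : stopping_index F t h b ->
  (forall w, (b w <= N)%N) -> F t A ->
  \int[P]_(w in A) sampled X t h (fun j => dynprog p h psi (N - j)) b w <=
  \int[P]_(w in A) dynprog p h psi N (X w t).
Proof.
move=> Fb bN FA.
have -> : \int[P]_(w in A) dynprog p h psi N (X w t) =
    \int[P]_(w in A) sampled X t h (fun j => dynprog p h psi (N - j)) (cst 0%N) w.
  by apply: eq_Rintegral => w _; rewrite /sampled /= subn0 /grid mulr0n addr0.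
apply: (le_Rintegral_sampled filF adX mkX t0 h0 (M := M)) => //.
- by move=> j; exact: bounded_measurable_dynprog.
- exact: stopping_index_cst.
- move=> w j /andP[_ jb]; have jN : (j < N)%N by apply: leq_trans (bN w).
  by rewrite -(subnSK jN); exact: expectation_dynprog.
Qed.

End first_contact.
End stopping.

(** * The réduite as a supremum of dynamic programs *)

Section continuous_bounded.
Context {R : realType}.

Lemma continuous_borel_measurable (T : ptopologicalType) (f : T -> R) :
  continuous f -> measurable_fun setT (f : borel T -> R).
Proof.
move=> /continuousP cf.
apply: (measurability _ (RGenOpens.measurableE R)) => _ [_ [a [b ->]] <-].
by rewrite setTI; apply: sub_sigma_algebra; exact/cf/interval_open.
Qed.

Lemma Cb_bounded_measurable (T : ptopologicalType) (f : T -> R) :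
  Cb R T f -> exists M, bounded_measurable M (f : borel T -> R).
Proof.
(* [bounded_fun] gives bounds strictly above [M] only. *)
move=> [cf [M [_ fM]]]; exists (M + 1); split.
  exact: continuous_borel_measurable.
by move=> x; apply: fM => //; rewrite ltrDl.
Qed.

End continuous_bounded.

Section reduite.
Context {R : realType} {O : completeMetricType R}.
Local Notation E := (borel (cem O)).
Variable p : R -> R.-pker E ~> E.
Variable Z : cem O -> process_basis (O := O).
Hypothesis stZ : started_processes p Z.
Variables (psi : cem O -> R) (M : R).
Hypotheses (cpsi : continuous psi) (bpsi : bounded_measurable M (psi : E -> R)).

Local Notation PZ x := (basis_prob (Z x)).
Local Notation FZ x := (@basis_filtration _ _ (Z x)).
Local Notation XZ x := (@basis_process _ _ (Z x)).

Let filZ x : filtration (FZ x).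
Proof. by have [[]] := stZ x. Qed.

Let adZ x : adapted (FZ x) (fun t w => XZ x w t : E).
Proof. by have [[_ _ _ _ []]] := stZ x. Qed.

Let mkZ x : markov (PZ x) (FZ x) (XZ x) p.
Proof. by have [] := stZ x. Qed.

Let Rintegral_start x f : bounded_measurable M (f : E -> R) ->
  \int[PZ x]_w f (XZ x w 0) = f x.
Proof.
move=> bf.
have bfX := bounded_measurable_process (filZ x) (adZ x) (lexx 0) bf.
rewrite -[RHS]mulr1 (_ : 1 = fine (PZ x setT)); last first.
  by rewrite (_ : PZ x setT = 1%E)//; exact: probability_setT.
rewrite -Rintegral_cst//; congr fine; apply: ae_eq_integral => //.
- by apply/measurable_EFinP; exact: bfX.1.
- by have [_ + _ _] := stZ x; apply: filterS => w ->.
Qed.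

Let stopping_after0 x sigma : stopping_time (FZ x) sigma ->
  stopping_time_after (FZ x) 0 sigma.
Proof. by move=> Fs; split=> //; case: Fs. Qed.

(** The first contact time on the grid is an admissible rule, and its reward is at least the dynamic
    program started at [x]. *)
Lemma reduite_ge_dynprog n k x :
  dynprog p (mesh n) psi k x <= reduite Z psi x.
Proof.
have h0 : 0 < mesh n :> R by exact: mesh_gt0.
have FN := stopping_index_first_contact p (filZ x) (adZ x) (lexx 0) k h0 bpsi.
(* The constant index [k] is never below the first contact, so the minimum of the two is the first
   contact itself. *)
have Fk := stopping_index_cst (filZ x) (lexx 0) h0 k.
have FT := filtrationT (filZ x) (lexx 0).
have := Rintegral_first_contact (filZ x) (adZ x) (@mkZ x) (lexx 0) k h0 bpsi Fk FT.
rewrite Rintegral_start; last exact: bounded_measurable_dynprog.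
move=> /le_trans; apply.
pose sigma w : R := grid 0 (mesh n) (first_contact p (XZ x) 0 (mesh n) k psi w).
have [Fs _] : stopping_time_after (FZ x) 0 sigma by exact: stopping_time_grid.
apply: ub_le_sup.
  (* [sup] is a genuine upper bound only for a set bounded above; rewards are at most [M]. *)
  exists M => _ [s /stopping_after0 Fs' <-].
  have bs := bounded_measurable_stopped (PZ x) (filZ x) (adZ x) (lexx 0) cpsi bpsi Fs'.
  have Mc : \int[PZ x]_w M = M.
    rewrite Rintegral_cst// [fine _](_ : _ = 1) ?mulr1//.
    by apply: (congr1 fine (y := 1%E)); exact: probability_setT.
  rewrite -[leRHS]Mc; apply: le_Rintegral => //.
  - exact: integrable_bounded_measurable (prob_lty _) measurableT bs.
  - exact: integrable_cst_finite (prob_lty _) measurableT.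
  - by move=> w _; rewrite (le_trans (ler_norm _))// bs.2.
exists sigma => //; apply: eq_Rintegral => w _.
rewrite /sampled (minn_idPr (first_contact_le _ _ _ _ _ _ _)).
by have /eqP -> := contact_first_contact p (XZ x) 0 (mesh n) k psi w.
Qed.

(** A stopping time is the limit of grid times capped at finite horizons. The reward of each such
    time is at most the dynamic program, hence at most [c], and bounded convergence concludes. *)
Lemma reduite_le x c : (forall n k, dynprog p (mesh n) psi k x <= c) ->
  reduite Z psi x <= c.
Proof.
move=> dc; apply: ge_sup.
  exists (\int[PZ x]_w psi (XZ x w (cst 0 w))), (cst 0) => //.
  by have [] := stopping_time_after_cst (filZ x) (lexx 0).
move=> _ [sigma Fs <-].
have Fs0 := stopping_after0 Fs.
(* The cap [n * 2 ^ n] is the date [n], because [mesh n *+ 2 ^ n] is 1; it leaves a path alone as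
   soon as [n] exceeds [sigma w]. *)
pose b n w := minn (grid_index 0 (mesh n : R) sigma w) (n * 2 ^ n).
have Fb n : stopping_index (FZ x) 0 (mesh n) (b n).
  apply: stopping_index_minn => //; [exact: mesh_gt0| |].
    exact: stopping_index_grid_index (mesh_gt0 n) Fs0.
  exact: stopping_index_cst (mesh_gt0 n) _.
have bb n : bounded_measurable M (sampled (XZ x) 0 (mesh n) (fun=> psi) (b n)).
  exact: (bounded_measurable_sampled (filZ x) (adZ x) (lexx 0) (mesh_gt0 n)).
have cvb w : sampled (XZ x) 0 (mesh n) (fun=> psi) (b n) w @[n --> \oo]
    --> psi (XZ x w (sigma w)).
  apply: cvg_trans (@cvg_approx _ _ _ _ _ _ _ _ cpsi _ w Fs0).
  apply: near_eq_cvg; exists (Num.truncn (sigma w)).+1 => // n /= sn.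
  rewrite /sampled (_ : b n w = grid_index 0 (mesh n) sigma w)//.
  apply/minn_idPl; rewrite grid_index_leq; [|exact: mesh_gt0|exact: Fs.1].
  rewrite /grid add0r mulnC mulrnA.
  have <- : mesh 0 = mesh n *+ 2 ^ n :> R by rewrite (meshM n 0) add0n.
  by rewrite /mesh expr0 invr1 (lt_le_trans (truncnS_gt _))// ler_nat.
have [_ cv] := cvg_Rintegral_bounded (prob_lty (PZ x)) measurableT bb cvb.
apply: (closed_cvg _ (@closed_le _ c) _ _ cv); apply: nearW => n /=.
have FT := filtrationT (filZ x) (lexx 0).
apply: le_trans (dc n (n * 2 ^ n)%N).
rewrite -(Rintegral_start x (bounded_measurable_dynprog p bpsi _ _)).
have bN w : (b n w <= n * 2 ^ n)%N by exact: geq_minr.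
apply: le_trans (Rintegral_dynprog_ge (filZ x) (adZ x) (@mkZ x) (lexx 0)
  (mesh_gt0 n) bpsi (Fb n) bN FT).
apply: le_Rintegral => //.
- exact: integrable_bounded_measurable (prob_lty _) measurableT (bb n).
- apply: (integrable_bounded_measurable (M := M) (prob_lty _) measurableT).
  apply: (bounded_measurable_sampled (filZ x) (adZ x) (lexx 0) (mesh_gt0 n) _ (Fb n)).
  by move=> j; exact: bounded_measurable_dynprog.
- by move=> w _; exact: dynprog_ge.
Qed.

End reduite.

(** * The value process *)

Section stopped_sigma_algebra.
Context {R : realType} {d : measure_display} {Omega : topMeasurableType d}.
Variables (P : probability Omega R) (F : R -> set (set Omega)).
Hypothesis filF : filtration F.

Lemma sigma_algebra_stopped sigma : stopping_time F sigma ->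
  sigma_algebra setT (stopped_sigma_algebra F sigma).
Proof.
move=> [s0 Fs]; split.
- by split=> // t t0; rewrite set0I; exact: filtration0.
- move=> A [mA FA]; split; first exact: measurableD.
  move=> t t0; rewrite (_ : _ `&` _ =
      [set w | sigma w <= t] `&` ~` (A `&` [set w | sigma w <= t])).
    apply: filtrationI => //; first exact: Fs.
    by apply: filtrationC => //; exact: FA.
  rewrite setTD; apply/seteqP; split => w /=.
    by move=> [nA ->]; split => // -[].
  by move=> [st nAst]; split=> // Aw; exact: nAst.
- move=> A FA; split; first by apply: bigcup_measurable => n _; have [] := FA n.
  move=> t t0; rewrite setI_bigcupl; apply: filtration_bigcup => // n.
  by have [_] := FA n; exact.
Qed.

Lemma stopped_sigma_algebra_after t sigma A : 0 <= t ->
  stopping_time_after F t sigma -> F t A -> stopped_sigma_algebra F sigma A.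
Proof.
move=> t0 [[s0 Fs] ts] FA; split; first exact: (measurable_filtration filF t0).
move=> s s_ge0; have [t_s|s_t] := leP t s.
  apply: filtrationI => //; last exact: Fs.
  exact: (filtration_le filF t0).
rewrite (_ : _ `&` _ = set0); first exact: filtration0.
by apply/seteqP; split => w //= [_]; rewrite leNgt (lt_le_trans s_t).
Qed.

(** Since [sigma >= t], [F t] is contained in the sigma-algebra stopped at [sigma], so the
    conditional inequality may be integrated over [A]. *)
Lemma submartingale_Rintegral S t sigma rho A : submartingale P F S ->
  0 <= t -> stopping_time_after F t sigma -> stopping_time_after F t rho ->
  (forall w, sigma w <= rho w) -> F t A ->
  \int[P]_(w in A) S (sigma w) w <= \int[P]_(w in A) S (rho w) w.
Proof.
move=> [_ intS subS] t0 Fs Fr sr FA.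
have mA := measurable_filtration filF t0 FA.
have sG := sigma_algebra_stopped Fs.1.
have mG : stopped_sigma_algebra F sigma `<=` measurable by move=> B [].
have ir : P.-integrable setT (EFin \o (fun w => S (rho w) w)) by exact: intS Fr.1.
have is_ : P.-integrable setT (EFin \o (fun w => S (sigma w) w)).
  exact: intS Fs.1.
have GA := stopped_sigma_algebra_after t0 Fs FA.
rewrite -(Rintegral_cond_exp sG mG ir GA).
have [_ iC _] := is_cond_exp_cond_exp sG mG ir.
apply: ae_le_Rintegral => //; [exact: (integrableS measurableT)..|].
exact: subS Fs.1 Fr.1 sr.
Qed.

End stopped_sigma_algebra.

Section value_process.
Context {R : realType} {O : completeMetricType R}.
Local Notation E := (borel (cem O)).
Variable p : R -> R.-pker E ~> E.
Context {d : measure_display} {Omega : topMeasurableType d}.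
Variables (P : probability Omega R) (F : R -> set (set Omega)).
Variable X : Omega -> skorokhod (cem O).
Hypothesis filF : filtration F.
Hypothesis adX : adapted F (fun t w => X w t : E).
Hypothesis mkX : markov P F X p.
Variable S : R -> Omega -> R.
Hypothesis subS : submartingale P F S.
Variable t : R.
Hypothesis t0 : 0 <= t.

Let gain (f : cem O -> R) (sigma : Omega -> R) w : R :=
  f (X w (sigma w)) - S (sigma w) w.

Let sF : sigma_algebra setT (F t).
Proof. by have [+ _ _] := filF; exact. Qed.

Let mF : F t `<=` measurable.
Proof. by have [_ + _] := filF; exact. Qed.

Section integrability.
Variables (f : cem O -> R) (M : R).
Hypotheses (cf : continuous f) (bf : bounded_measurable M (f : E -> R)).

Let integrable_reward A sigma : measurable A -> stopping_time_after F t sigma ->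
  P.-integrable A (EFin \o (fun w => f (X w (sigma w)))).
Proof.
move=> mA Fs.
apply: (integrable_bounded_measurable (M := M) (prob_lty P) mA).
exact: (bounded_measurable_stopped P filF adX t0).
Qed.

Let integrable_cost A sigma : measurable A -> stopping_time_after F t sigma ->
  P.-integrable A (EFin \o (fun w => S (sigma w) w)).
Proof.
move=> mA [Fs _]; apply: (integrableS measurableT) => //.
by have [_ + _] := subS; exact.
Qed.

Lemma integrable_gain sigma : stopping_time_after F t sigma ->
  P.-integrable setT (EFin \o gain f sigma).
Proof.
move=> Fs; exact: (integrableB measurableT (integrable_reward measurableT Fs)
  (integrable_cost measurableT Fs)).
Qed.

Lemma Rintegral_gain sigma A : stopping_time_after F t sigma -> F t A ->
  \int[P]_(w in A) gain f sigma w =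
  \int[P]_(w in A) f (X w (sigma w)) - \int[P]_(w in A) S (sigma w) w.
Proof.
move=> Fs /mF mA.
exact: (RintegralB mA (integrable_reward mA Fs) (integrable_cost mA Fs)).
Qed.

Lemma measurable_wrt_process s (g : cem O -> R) : 0 <= s ->
  measurable_fun setT (g : E -> R) -> measurable_wrt (F s) (fun w => g (X w s)).
Proof.
move=> s0 mg B mB; rewrite -/((g \o (fun w => X w s)) @^-1` B) comp_preimage.
by apply: adX => //; rewrite -[_ @^-1` _]setTI; exact: mg.
Qed.

(** The cost being at least [m], conditional gains are at most [M - m]; with the gain of stopping at
    [t] as integrable member, [is_ess_sup_ex] applies and the value process is a true essential
    supremum rather than a default value. *)
Lemma is_ess_sup_value_process m :
  {ae P, forall w s, 0 <= s -> m <= S s w} ->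
  is_ess_sup P [set EFin \o cond_exp P (F t) (gain f sigma)
    | sigma in stopping_time_after F t] (value_process P F X S f t).
Proof.
move=> mS.
pose H := [set cond_exp P (F t) (gain f sigma)
  | sigma in stopping_time_after F t].
have HE : [set EFin \o y | y in H] = [set EFin \o cond_exp P (F t) (gain f sigma)
    | sigma in stopping_time_after F t] by rewrite /H image_comp.
have Ht := stopping_time_after_cst filF t0.
have [||y [s Fs <-]|y [s Fs <-]|z] := @is_ess_sup_ex R d Omega P H
  (cond_exp P (F t) (gain f (cst t))) (M - m).
- by exists (cst t).
- by have [] := is_cond_exp_cond_exp sF mF (integrable_gain Ht).
- have [my _ _] := is_cond_exp_cond_exp sF mF (integrable_gain Fs).
  exact: (measurable_wrt_measurable mF my).
- have [my iy _] := is_cond_exp_cond_exp sF mF (integrable_gain Fs).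
  have mc : measurable_wrt (F t) (cst (M - m) : Omega -> R).
    by apply/(measurable_wrtP sF); exact: measurable_cst.
  have ic A : measurable A -> P.-integrable A (EFin \o cst (M - m)).
    exact: (integrable_cst_finite (M - m) (prob_lty P)).
  apply: (ae_le_measurable_wrt sF mF my mc iy (ic _ measurableT)) => A FA.
  rewrite (Rintegral_cond_exp sF mF (integrable_gain Fs) FA).
  have mA := mF FA.
  apply: ae_le_Rintegral => //; [|exact: ic|].
    by apply: (integrableS measurableT) => //; exact: integrable_gain.
  apply: filterS mS => w /(_ (s w) (Fs.1.1 w)) mSw.
  by apply: lerB => //; rewrite (le_trans (ler_norm _))// bf.2.
- by rewrite HE => /is_ess_sup_essential_sup.
Qed.

(** An almost sure comparison of [F t]-measurable functions amounts to comparing integrals over the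
    events of [F t]; this supplies what such a comparison needs for a conditional gain shifted by a
    function of [X w t]. *)
Lemma cond_exp_gain_shift sigma (g : cem O -> R) N :
  stopping_time_after F t sigma -> bounded_measurable N (g : E -> R) ->
  let Y w := cond_exp P (F t) (gain f sigma) w + g (X w t) in
  [/\ measurable_wrt (F t) Y, P.-integrable setT (EFin \o Y) &
    forall A, F t A -> \int[P]_(w in A) Y w =
      \int[P]_(w in A) f (X w (sigma w)) - \int[P]_(w in A) S (sigma w) w +
      \int[P]_(w in A) g (X w t)].
Proof.
move=> Fs bg Y.
have ig := integrable_gain Fs.
have [mC iC _] := is_cond_exp_cond_exp sF mF ig.
have bgX := bounded_measurable_process filF adX t0 bg.
have igX A : measurable A -> P.-integrable A (EFin \o (fun w => g (X w t))).
  by move=> mA; exact: (integrable_bounded_measurable (prob_lty P) mA bgX).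
split.
- by apply: measurable_wrtD => //; apply: measurable_wrt_process => //; exact: bg.1.
- exact: (integrableD measurableT iC (igX _ measurableT)).
- move=> A FA; have mA := mF FA.
  rewrite RintegralD//; [|exact: (integrableS measurableT)|exact: igX].
  by rewrite (Rintegral_cond_exp sF mF ig FA) Rintegral_gain.
Qed.

End integrability.

(** * Comparison of the gains of [psi] and [psibar] *)

Variables (psi v : cem O -> R) (M : R).
Hypotheses (cpsi : continuous psi) (bpsi : bounded_measurable M (psi : E -> R)).
Hypothesis cv : continuous v.
Hypothesis sg : transition_semigroup p.
Hypothesis v_ub : forall n k x, dynprog p (mesh n) psi k x <= v x.
Hypothesis v_lub : forall x c,
  (forall n k, dynprog p (mesh n) psi k x <= c) -> v x <= c.

Let bv : bounded_measurable M (v : E -> R).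
Proof. exact: (bounded_measurable_sup_dynprog bpsi sg v_ub v_lub). Qed.

Let exc n x : expectation p (mesh n) v x <= v x.
Proof. exact: (expectation_sup_dynprog bpsi sg v_ub v_lub). Qed.

Let psibar x := psi x - v x.

Let cpsibar : continuous psibar.
Proof. by move=> x; exact: (continuousB (@cpsi x) (@cv x)). Qed.

Let bpsibar : bounded_measurable (M + M) (psibar : E -> R).
Proof. exact: bounded_measurableD bpsi (bounded_measurableN bv). Qed.

Let psibar_le0 x : psibar x <= 0.
Proof. by rewrite subr_le0; exact: (v_ub 0 0). Qed.

Let Rintegral_psibar sigma A : stopping_time_after F t sigma -> F t A ->
  \int[P]_(w in A) psibar (X w (sigma w)) =
  \int[P]_(w in A) psi (X w (sigma w)) - \int[P]_(w in A) v (X w (sigma w)).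
Proof.
move=> Fs /mF mA; apply: RintegralB => //.
- exact: (integrable_bounded_measurable (prob_lty P) mA
    (bounded_measurable_stopped P filF adX t0 cpsi bpsi Fs)).
- exact: (integrable_bounded_measurable (prob_lty P) mA
    (bounded_measurable_stopped P filF adX t0 cv bv Fs)).
Qed.

(** The two gains differ by [v] at [sigma], whose conditional expectation is at most [v (X w t)]
    because [v] along [X] is a supermartingale. *)
Lemma cond_exp_gain_le sigma : stopping_time_after F t sigma ->
  {ae P, forall w, cond_exp P (F t) (gain psi sigma) w <=
    cond_exp P (F t) (gain psibar sigma) w + v (X w t)}.
Proof.
move=> Fs.
have ig := integrable_gain cpsi bpsi Fs.
have [mC iC _] := is_cond_exp_cond_exp sF mF ig.
have [mY iY EY] := cond_exp_gain_shift cpsibar bpsibar Fs bv.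
apply: (ae_le_measurable_wrt sF mF mC mY iC iY) => A FA.
rewrite EY// (Rintegral_cond_exp sF mF ig FA) (Rintegral_gain cpsi bpsi Fs FA).
rewrite Rintegral_psibar//.
have := le_Rintegral_stopped filF adX mkX t0 cv bv exc
  (stopping_time_after_cst filF t0) Fs Fs.2 FA.
by rewrite /cst; lra.
Qed.

(* Stop [sigma] at the first grid time where the dynamic program with the
   remaining horizon touches [psi]: up to that time its values form a
   martingale, and there is no gap between [psi] and it afterwards. *)
Lemma cond_exp_gain_dynprog_le n N sigma : stopping_time_after F t sigma ->
  exists2 rho, stopping_time_after F t rho &
  {ae P, forall w, cond_exp P (F t) (gain psibar sigma) w +
      dynprog p (mesh n) psi N (X w t) <=
    cond_exp P (F t) (gain psi rho) w}.
Proof.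
move=> Fs; have h0 : 0 < mesh n :> R by exact: mesh_gt0.
set h := mesh n in h0 *.
pose c := first_contact p X t h N psi.
pose b := grid_index t h sigma.
pose e w := minn (b w) (c w).
have Fc : stopping_index F t h c by exact: stopping_index_first_contact bpsi.
have Fb : stopping_index F t h b by exact: stopping_index_grid_index.
have Fe : stopping_index F t h e by exact: stopping_index_minn.
(* Two versions of the same rule. [rho] never exceeds [sigma], as the submartingale comparison
   requires; [rho'] lies on the grid, as the dynamic program requires, and may come after
   [sigma]. *)
pose rho w := Num.min (sigma w) (grid t h (c w)).
pose rho' w := grid t h (e w).
have Frho : stopping_time_after F t rho.
  by apply: stopping_time_after_min => //; exact: stopping_time_grid.
have Frho' : stopping_time_after F t rho' by exact: stopping_time_grid.
have b_le w j : (b w <= j)%N = (sigma w < grid t h j).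
  by apply: grid_index_leq => //; exact: Fs.2.
have rho_le w : rho w <= rho' w.
  rewrite /rho /rho' /e; case: (leqP (b w) (c w)) => bc.
    rewrite ge_min; apply/orP; left; apply: ltW.
    by rewrite -b_le.
  by rewrite ge_min lexx orbT.
exists rho => //.
have igr := integrable_gain cpsi bpsi Frho.
have [mC iC _] := is_cond_exp_cond_exp sF mF igr.
have bd := bounded_measurable_dynprog p bpsi h N.
have [mY iY EY] := cond_exp_gain_shift cpsibar bpsibar Fs bd.
apply: (ae_le_measurable_wrt sF mF mY mC iY iC) => A FA.
have mA := mF FA.
rewrite EY// (Rintegral_cond_exp sF mF igr FA) (Rintegral_gain cpsi bpsi Frho FA).
have leS : \int[P]_(w in A) S (rho w) w <= \int[P]_(w in A) S (sigma w) w.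
  apply: (submartingale_Rintegral filF subS t0 Frho Fs) => // w.
  by rewrite ge_min lexx.
(* Rounding up to the grid can only lower [v] in mean. *)
have lev : \int[P]_(w in A) v (X w (rho' w)) <= \int[P]_(w in A) v (X w (rho w)).
  exact: (le_Rintegral_stopped filF adX mkX t0 cv bv exc Frho Frho' rho_le FA).
pose u j := dynprog p h psi (N - j).
have led : \int[P]_(w in A) dynprog p h psi N (X w t) <=
    \int[P]_(w in A) sampled X t h u e w.
  exact: (Rintegral_first_contact filF adX mkX t0 N h0 bpsi Fb FA).
have bu : bounded_measurable M (sampled X t h u e).
  apply: (bounded_measurable_sampled filF adX t0 h0 _ Fe) => j.
  exact: bounded_measurable_dynprog.
have int f K : bounded_measurable K f -> P.-integrable A (EFin \o f).
  exact: (integrable_bounded_measurable (prob_lty P) mA).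
have stop f K : continuous f -> bounded_measurable K (f : E -> R) ->
    forall r, stopping_time_after F t r ->
    bounded_measurable K (fun w => f (X w (r w))).
  by move=> cf bf r Fr; exact: (bounded_measurable_stopped P filF adX t0 cf bf Fr).
have b1 := stop _ _ cpsibar bpsibar _ Fs.
have b2 := stop _ _ cv bv _ Frho.
have b3 := stop _ _ cv bv _ Frho'.
have b4 := stop _ _ cpsi bpsi _ Frho.
have b12 := bounded_measurableD b1 b2.
have b3u := bounded_measurableD (bounded_measurableN b3) bu.
(* The integrands are compared pointwise. If [b <= c], then [rho] is [sigma], where [psibar + v] is
   [psi], and the dynamic program at [rho'] is at most [v]. If [c < b], both times are the contact
   date, the dynamic program there is [psi], and [psibar <= 0]. *)
have : \int[P]_(w in A) (psibar (X w (sigma w)) + v (X w (rho w)) +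
      (- v (X w (rho' w)) + sampled X t h u e w)) <=
    \int[P]_(w in A) psi (X w (rho w)).
  apply: le_Rintegral => //; [|exact: (int _ _ b4)|].
    exact: (int _ _ (bounded_measurableD b12 b3u)).
  move=> w _; rewrite /sampled /rho /rho' /e.
  case: (leqP (b w) (c w)) => bc.
    move: (bc); rewrite b_le => /ltW /min_idPl ->.
    have := v_ub n (N - b w) (X w (grid t h (b w))).
    by rewrite /psibar /u; lra.
  move: (bc); rewrite ltnNge b_le -leNgt => /min_idPr ->.
  have /eqP := contact_first_contact p X t h N psi w.
  rewrite -/(c w) /u => ->; have := psibar_le0 (X w (sigma w)).
  by lra.
rewrite RintegralD//; [|exact: (int _ _ b12)|exact: (int _ _ b3u)].
rewrite RintegralD//; [|exact: (int _ _ b1)|exact: (int _ _ b2)].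
rewrite [X in _ + _ + X]RintegralD//; last exact: (int _ _ bu); last first.
  exact: (int _ _ (bounded_measurableN b3)).
rewrite [X in _ + _ + (X + _)]RintegralN//; last exact: (int _ _ b3).
by move: leS lev led; lra.
Qed.

(** Two essential suprema of the same family agree almost everywhere, so it suffices that the
    right-hand side be one for the [psibar]-gains. It is a bound by [cond_exp_gain_dynprog_le] and
    the least one by [cond_exp_gain_le]. *)
Lemma value_process_shift m : {ae P, forall w s, 0 <= s -> m <= S s w} ->
  {ae P, forall w, value_process P F X S psibar t w =
    (value_process P F X S psi t w - (v (X w t))%:E)%E}.
Proof.
move=> mS.
have Ibar := is_ess_sup_value_process cpsibar bpsibar mS.
have [mG ubG lubG] := is_ess_sup_value_process cpsi bpsi mS.
have mvX : measurable_fun setT (fun w => (v (X w t))%:E).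
  by apply/measurable_EFinP; have [] := bounded_measurable_process filF adX t0 bv.
apply: (ae_eq_is_ess_sup Ibar); split.
- exact: emeasurable_funB.
- move=> _ [sigma Fs <-].
  (* Meshes and horizons are countable, so one null set serves for all of them before the supremum
     is taken at a fixed [w]. *)
  have : {ae P, forall w n N, ((cond_exp P (F t) (gain psibar sigma) w +
      dynprog p (mesh n) psi N (X w t))%:E <= value_process P F X S psi t w)%E}.
    apply: ae_foralln => n; apply: ae_foralln => N.
    have [rho Fr] := cond_exp_gain_dynprog_le n N Fs.
    have : {ae P, forall w, ((cond_exp P (F t) (gain psi rho) w)%:E <=
        value_process P F X S psi t w)%E} by apply: ubG; exists rho.
    by apply: filterS2 => w le2 le1; apply: le_trans le2; rewrite lee_fin.
  (* The value process is extended real: +oo is trivial, and -oo is excluded by the real lower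
     bounds [le_r]. *)
  apply: filterS => w /=; case: (value_process _ _ _ _ _ _ w) => [r| |] le_r.
  + rewrite -EFinB lee_fin lerBrDr -lerBrDl; apply: v_lub => n N.
    by rewrite lerBrDl -lee_fin.
  + by rewrite leey.
  + by have := le_r 0%N 0%N.
- move=> Z' mZ' ubZ'.
  have : {ae P, forall w, (value_process P F X S psi t w <=
      Z' w + (v (X w t))%:E)%E}.
    apply: lubG; first exact: emeasurable_funD.
    move=> _ [sigma Fs <-].
    have := cond_exp_gain_le Fs.
    have : {ae P, forall w, ((cond_exp P (F t) (gain psibar sigma) w)%:E <=
        Z' w)%E} by apply: ubZ'; exists sigma.
    apply: filterS2 => w le1 le2; rewrite /= (le_trans (y := (cond_exp P (F t)
      (gain psibar sigma) w + v (X w t))%:E))// ?lee_fin// EFinD.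
    exact: leeD2r.
  by apply: filterS => w le_w; rewrite leeBlDr.
Qed.

End value_process.

Theorem proposition3p3
  (R : realType) (O : completeMetricType R)
  (d : measure_display) (Omega : topMeasurableType d)
  (P : probability Omega R) (F : R -> set (set Omega))
  (X : Omega -> skorokhod (cem O))
  (mu : probability (borel O) R)
  (S pS : R -> Omega -> R)
  (p : R -> R.-pker (borel (cem O)) ~> (borel (cem O)))
  (Z : cem O -> process_basis (O := O))
  (psi : cem O -> R)
  (setting : process_setting P F X)
  (law0 : initial_law P X mu)
  (lifetime_integrable : (\int[P]_w lifetime X w < +oo)%E)
  (absorbed : {ae P, forall w, forall t : R, 0 <= t ->
     (lifetime X w <= t%:E)%E -> X w t = cemetery})
  (accessible : forall Q : set O, open Q -> Q !=set0 ->
     exists2 sigma, stopping_time F sigma &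
       (0 < P [set w | exists2 x, Q x & X w (sigma w) = alive x])%E)
  (S_adapted : adapted F S)
  (S_measurable : measurable_fun ([set t : R | (0 <= t)%R] `*` setT)
     (fun q : R * Omega => S q.1 q.2))
  (S_right_lsc : {ae P, forall w, right_lower_semicontinuous (S^~ w)})
  (pS_projection : predictable_projection P F S pS)
  (pS_left_lsc : {ae P, forall w, left_lower_semicontinuous (pS^~ w)})
  (S_bounded_below : exists m : R,
     {ae P, forall w, forall t : R, 0 <= t -> m <= S t w})
  (S_constant : {ae P, forall w, forall t : R, (lifetime X w < t%:E)%E ->
     S t w = S (fine (lifetime X w)) w})
  (S_ui : uniformly_integrable P
     [set (fun w => S (sigma w) w) | sigma in stopping_time F])
  (S0 : {ae P, forall w, S 0 w = 0})
  (S_submartingale : submartingale P F S)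
  (p_semigroup : transition_semigroup p)
  (p_feller : feller_continuous p)
  (X_markov : markov P F X p)
  (Z_started : started_processes p Z)
  (reduite_continuous : forall phi,
     Cb R (cem O) phi -> Cb R (cem O) (reduite Z phi))
  (psi_Cb : Cb R (cem O) psi) :
  let psibar := fun x => psi x - reduite Z psi x in
  forall t : R, 0 <= t ->
    {ae P, forall w,
       value_process P F X S psibar t w =
       (value_process P F X S psi t w - (reduite Z psi (X w t))%:E)%E}.
Proof.
have [_ filF _ _ [_ adX]] := setting.
have [M bpsi] := Cb_bounded_measurable psi_Cb.
have [cpsi _] := psi_Cb.
have [cv _] := reduite_continuous _ psi_Cb.
have [m mS] := S_bounded_below.
move=> psibar t t0.
apply: (value_process_shift filF adX X_markov S_submartingale t0 cpsi bpsi cv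
  p_semigroup _ _ mS).
(* The réduite lives on the bases [Z x] and the value process on [P]; they meet through the dynamic
   programs, which are built from the kernel [p] and refer to no basis. *)
- by move=> n k x; exact: (reduite_ge_dynprog Z_started cpsi bpsi).
- by move=> x c; exact: (reduite_le Z_started cpsi bpsi).
Qed.
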